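(* (Preservation of volume and symplectic structure.) Let $U:\mathbb{R}^d\to\mathbb{R}$ be continuously differentiable and $\ell$-Lipschitz for some $\ell>0$, let $K:\mathbb{R}^d\to\mathbb{R}$ be a differentiable kinetic energy, let $H(q,p)=U(q)+K(p)$, and let $\gamma>0$ and $T>0$. For $0\le t\le T$ let $z_t=(q_t,p_t)$ be the position at time $t$ under the repelling-attracting dynamics started at $z_0=(q_0,p_0)\in\mathbb{R}^{2d}$, and let $\omega_t$ be the symplectic $2$-form given by the wedge product $\omega_t=\mathrm{d}q_t\wedge\mathrm{d}p_t$. Then the repelling-attracting dynamics preserves symplectic structure only when $t=T$, i.e., $$\omega_T=\omega_0,$$ and, in particular, for all $z\in\mathbb{R}^{2d}$, $$D\Psi_T(z)^\top\,\Omega^{-1}\,D\Psi_T(z)=\Omega^{-1}.$$ Moreover, the integrators $\Psi_T$ (exact) and $\Psi_{\epsilon,L}$ (numerical) are volume preserving, i.e., $|\det(D\Psi_T)|=|\det(D\Psi_{\epsilon,L})|=1$.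
   Context: Points of $\mathbb{R}^{2d}$ are written $z=(q,p)$ with $q,p\in\mathbb{R}^d$; $DF(z)$ denotes the Jacobian matrix of $F$ at $z$, and $\Omega=\begin{pmatrix}0&I_d\\-I_d&0\end{pmatrix}$. The function $U=-\log\pi$ is the potential energy of a target density $\pi$ on $\mathbb{R}^d$. Repelling-attracting dynamics: starting from $z_0$ at $t=0$, $$\dot q_t=\nabla K(p_t),\quad \dot p_t=-\nabla U(q_t)+\gamma p_t\ \ (0<t\le T/2),\qquad \dot q_t=\nabla K(p_t),\quad \dot p_t=-\nabla U(q_t)-\gamma p_t\ \ (T/2<t\le T),$$ with $z_t$ continuous in $t$. The exact time-$T$ map is $\Psi_T:z_0\mapsto z_T$. The $2$-form $\omega_t=\mathrm{d}q_t\wedge\mathrm{d}p_t=\sum_{i=1}^d\mathrm{d}q_{t,i}\wedge\mathrm{d}p_{t,i}$ is regarded as a $2$-form in the initial state, i.e. it is the pullback of $\omega_0=\sum_{i=1}^d\mathrm{d}q_{0,i}\wedge\mathrm{d}p_{0,i}$ under the map $z_0\mapsto z_t$. Numerical scheme (conformal leapfrog, formulated for the quadratic kinetic energy $K(p)=\tfrac12p^\top\Sigma^{-1}p$ with $\Sigma\in\mathbb{R}^{d\times d}$ symmetric positive definite): for a step size $\epsilon>0$ let $\Phi^H_\epsilon:=\xi_1\circ\xi_2\circ\xi_1$ with $\xi_1(q,p)=(q,\,p-\tfrac{\epsilon}{2}\nabla U(q))$ and $\xi_2(q,p)=(q+\epsilon\Sigma^{-1}p,\,p)$, let $\eta^{\pm}(q,p)=(q,\,e^{\pm\gamma\epsilon/2}p)$,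 and let $\varphi^{\pm}_{[\epsilon]}:=\eta^{\pm}\circ\Phi^H_\epsilon\circ\eta^{\pm}$. For a positive integer $L$, $\Psi_{\epsilon,L}:=\big(\varphi^{-}_{[\epsilon]}\big)^{\lfloor L/2\rfloor}\circ\big(\varphi^{+}_{[\epsilon]}\big)^{\lfloor L/2\rfloor}$, where powers denote iterated composition.
   Formalization: Added: z_0 ↦ z_t is differentiable with Jacobian continuous in (t, z_0) on [0,T] (automatic for C² U and K), since otherwise ω_t and DΨ_T may not exist; |det DΨ_{ε,L}| = 1 is claimed where Ψ_{ε,L} is differentiable; d ≥ 1. *)

(* Defs.v *)
From HB Require Import structures.
From mathcomp Require Import all_boot all_order all_algebra.
From mathcomp Require Import all_classical all_reals all_analysis.

Set Implicit Arguments.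
Unset Strict Implicit.
Unset Printing Implicit Defensive.

Import Order.TTheory GRing.Theory Num.Theory.
Import numFieldNormedType.Exports.

Local Open Scope classical_set_scope.
Local Open Scope ring_scope.

(* Vectors are row vectors: z = (q, p) is [row_mx q p : 'rV[R]_(d + d)], and a
   matrix A acts on x as [x *m A^T]. *)

Definition qpart (R : realType) (d : nat) (z : 'rV[R]_(d + d)) : 'rV[R]_d :=
  lsubmx z.
Definition ppart (R : realType) (d : nat) (z : 'rV[R]_(d + d)) : 'rV[R]_d :=
  rsubmx z.

(* The library norm on 'rV[R]_n is the sup norm. *)
Definition enorm (R : realType) (n : nat) (x : 'rV[R]_n) : R :=
  Num.sqrt (\sum_i x ord0 i ^+ 2).

Definition elipschitz (R : realType) (n : nat) (l : R) (f : 'rV[R]_n -> R) :=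
  forall x y, `|f x - f y| <= l * enorm (x - y).

Definition grad (R : realType) (n : nat) (f : 'rV[R]_n -> R) (x : 'rV[R]_n) :
  'rV[R]_n := \row_i 'D_(delta_mx ord0 i) f x.

Definition C1 (R : realType) (n : nat) (f : 'rV[R]_n -> R) :=
  (forall x, differentiable f x) /\ continuous (grad f).

(* The library's ['J F z] acts on row vectors from the right; its transpose is
   the usual Jacobian, whose (i, j) entry is the derivative of F_i along z_j. *)
Definition Jac (R : realType) (n m : nat) (F : 'rV[R]_n -> 'rV[R]_m)
  (z : 'rV[R]_n) : 'M[R]_(m, n) := ('J F z)^T.

Definition Omega (R : realType) (d : nat) : 'M[R]_(d + d) :=
  block_mx 0 1%:M (- 1%:M) 0.

(* v is the derivative of x at t relative to A: one-sided when t is an end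
   point of the interval A. *)
Definition derive_within (R : realType) (n : nat) (A : set R)
  (x : R -> 'rV[R]_n) (t : R) (v : 'rV[R]_n) :=
  (s - t)^-1 *: (x s - x t) @[s --> within A t^'] --> v.

(* z solves the dynamics on [0, T]; its initial state is z 0. *)
Definition ra_trajectory (R : realType) (d : nat) (U K : 'rV[R]_d -> R)
  (gamma T : R) (z : R -> 'rV[R]_(d + d)) :=
  let q t := qpart (z t) in
  let p t := ppart (z t) in
  [/\ {within `[0, T], continuous z},
      forall t, 0 < t <= T / 2 ->
        derive_within `]0, T / 2] q t (grad K (p t)) /\
        derive_within `]0, T / 2] p t (- grad U (q t) + gamma *: p t)
    & forall t, T / 2 < t <= T ->
        derive_within `]T / 2, T] q t (grad K (p t)) /\
        derive_within `]T / 2, T] p t (- grad U (q t) - gamma *: p t)].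

(* Z t z0 is the state at time t of the trajectory started at z0, so that
   Z T is the exact time-T map. *)
Definition ra_flow (R : realType) (d : nat) (U K : 'rV[R]_d -> R)
  (gamma T : R) (Z : R -> 'rV[R]_(d + d) -> 'rV[R]_(d + d)) :=
  forall z0, Z 0 z0 = z0 /\ ra_trajectory U K gamma T (fun t => Z t z0).

(* Continuously differentiable dependence on the initial state; it is what
   gives a meaning to Jac (Z t) z and to pullbacks along Z t. *)
Definition C1_in_initial_state (R : realType) (d : nat) (T : R)
  (Z : R -> 'rV[R]_(d + d) -> 'rV[R]_(d + d)) :=
  (forall t, 0 <= t <= T -> forall z, differentiable (Z t) z) /\
  {within `[0, T] `*` [set: 'rV[R]_(d + d)],
    continuous (fun tz : R * 'rV[R]_(d + d) => Jac (Z tz.1) tz.2)}.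

(* A differential form on R^n is a function of the base point and of tangent
   vectors. *)
Definition form1 (R : realType) (n : nat) := 'rV[R]_n -> 'rV[R]_n -> R.
Definition form2 (R : realType) (n : nat) :=
  'rV[R]_n -> 'rV[R]_n -> 'rV[R]_n -> R.

Definition dform (R : realType) (n : nat) (f : 'rV[R]_n -> R) : form1 R n :=
  fun z u => 'd f z u.

Definition wedge (R : realType) (n : nat) (a b : form1 R n) : form2 R n :=
  fun z u v => a z u * b z v - a z v * b z u.

(* dq_t /\ dp_t as a 2-form in the initial state, where q_t and p_t are the
   components of z0 |-> Z t z0. *)
Definition omega (R : realType) (d : nat)
  (Z : R -> 'rV[R]_(d + d) -> 'rV[R]_(d + d)) (t : R) : form2 R (d + d) :=
  fun z u v => \sum_(i < d)
    wedge (dform (fun z0 => qpart (Z t z0) ord0 i))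
          (dform (fun z0 => ppart (Z t z0) ord0 i)) z u v.

Definition sympd (R : realType) (d : nat) (S : 'M[R]_d) :=
  S^T = S /\ forall x : 'rV[R]_d, x != 0 -> 0 < (x *m S *m x^T) ord0 ord0.

Definition xi1 (R : realType) (d : nat) (U : 'rV[R]_d -> R) (eps : R)
  (z : 'rV[R]_(d + d)) : 'rV[R]_(d + d) :=
  row_mx (qpart z) (ppart z - (eps / 2) *: grad U (qpart z)).

Definition xi2 (R : realType) (d : nat) (Sigma : 'M[R]_d) (eps : R)
  (z : 'rV[R]_(d + d)) : 'rV[R]_(d + d) :=
  row_mx (qpart z + eps *: (ppart z *m (invmx Sigma)^T)) (ppart z).

Definition PhiH (R : realType) (d : nat) (U : 'rV[R]_d -> R)
  (Sigma : 'M[R]_d) (eps : R) : 'rV[R]_(d + d) -> 'rV[R]_(d + d) :=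
  xi1 U eps \o xi2 Sigma eps \o xi1 U eps.

Definition eta (R : realType) (d : nat) (c eps : R)
  (z : 'rV[R]_(d + d)) : 'rV[R]_(d + d) :=
  row_mx (qpart z) (expR (c * eps / 2) *: ppart z).

(* One step with friction coefficient c: c = gamma repels, c = - gamma
   attracts. *)
Definition conf_leapfrog (R : realType) (d : nat) (U : 'rV[R]_d -> R)
  (Sigma : 'M[R]_d) (c eps : R) : 'rV[R]_(d + d) -> 'rV[R]_(d + d) :=
  eta c eps \o PhiH U Sigma eps \o eta c eps.

Definition Psi_num (R : realType) (d : nat) (U : 'rV[R]_d -> R)
  (Sigma : 'M[R]_d) (gamma eps : R) (L : nat) :
  'rV[R]_(d + d) -> 'rV[R]_(d + d) :=
  iter L./2 (conf_leapfrog U Sigma (- gamma) eps) \o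
  iter L./2 (conf_leapfrog U Sigma gamma eps).

(* Main.v *)
Require Import Defs.
From HB Require Import structures.
From mathcomp Require Import all_boot all_order all_fingroup all_algebra.
From mathcomp Require Import all_classical all_reals all_analysis.
From mathcomp Require Import ring lra zify.

Set Implicit Arguments.
Unset Strict Implicit.
Unset Printing Implicit Defensive.

Import Order.TTheory GRing.Theory Num.Theory.
Import numFieldNormedType.Exports.
Local Open Scope classical_set_scope.
Local Open Scope ring_scope.

(** Exact flow. [U] is only C^1 and [K] only differentiable, so the variational
    equation does not make sense. On each half put [P = e^(-ct) p], with
    [c = gamma] or [c = - gamma]. Along a line of initial states, the pullback
    of [sum q_i dP_i + e^(-ct) (U(q) + K(p)) dt] to the [(t, s)]-plane has
    coefficients which are merely continuous, but [q] and [H] are differentiable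
    at every point, and the pointwise curl vanishes by the equations of motion.
    Goursat's bisection argument then shows that the form is closed. So the
    difference of the forms [sum q_i dP_i] at two times is the differential of
    a function of the initial state, and the symmetry of second derivatives
    makes [e^(-ct) omega_t] constant: [omega_t] grows by the factor
    [e^(gamma t)] up to time [T / 2], and decreases back to [omega_0] at [T].

    Integrator. The map is not C^1, it is only assumed to be differentiable at
    the given point. After the rescalings of the momentum are moved to one
    side, where they cancel, it is a product of shears [p += h(q)] and
    [q += h(p)] with [h] continuous. Such a product is a locally uniform limit
    of injective maps of the lattices [(1/N) Z^n] (round the shears to the
    lattice). Counting lattice points in small cubes, after an LU
    decomposition of the derivative [J], gives [1 <= |det J|]; the inverse map
    gives the other inequality. *)

(** * Forms with continuous coefficients in the plane *)

Lemma mean_value_le (R : realType) (f df : R -> R) (a b M : R) :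
  a <= b -> (forall x, a <= x <= b -> is_derive x 1 f (df x)) ->
  (forall x, a <= x <= b -> `|df x| <= M) -> `|f b - f a| <= M * (b - a).
Proof.
move=> ab fd dfM.
have [||c /[!in_itv]/= cab ->] := @MVT_segment R f df a b ab.
- by move=> x /[!in_itv]/= /andP[ax xb]; apply: fd; rewrite !ltW.
- apply: derivable_within_continuous => x /[!in_itv]/= xab.
  by case: (fd x xab).
by rewrite normrM (ger0_norm (_ : 0 <= b - a)) ?subr_ge0// ler_wpM2r ?subr_ge0// dfM.
Qed.

(* The form [w dt + f ds] differs near [(t0, s0)], up to an error small
   compared with the distance, from [dG + kappa * (t - t0) ds]: so [kappa]
   plays the role of [d_t f - d_s w], which need not exist. *)
Definition curl_at (R : realType) (f w : R -> R -> R) (kappa t0 s0 : R) :=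
  exists G Gt Gs : R -> R -> R, forall e : R, 0 < e -> exists2 r : R, 0 < r &
    forall t s, `|t - t0| < r -> `|s - s0| < r ->
      [/\ is_derive s 1 (G t) (Gs t s), is_derive t 1 (G^~ s) (Gt t s),
          `|f t s - Gs t s - kappa * (t - t0)| <= e * (`|t - t0| + `|s - s0|) &
          `|w t s - Gt t s| <= e * (`|t - t0| + `|s - s0|)].

(* If [A t] is a primitive of [f t] and [B^~ s] one of [w^~ s], this is the
   integral of [w dt + f ds] along the boundary of a rectangle. *)
Definition circulation (R : realType) (A B : R -> R -> R) (t1 t2 s1 s2 : R) : R :=
  (A t2 s2 - A t2 s1) - (A t1 s2 - A t1 s1)
  - ((B t2 s2 - B t1 s2) - (B t2 s1 - B t1 s1)).

Lemma curl_at_circulation (R : realType) (f w : R -> R -> R) (kappa t0 s0 : R) :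
  curl_at f w kappa t0 s0 -> forall e : R, 0 < e -> exists2 r : R, 0 < r &
  forall (A B : R -> R -> R) (t1 t2 s1 s2 : R),
    t1 <= t0 <= t2 -> s1 <= s0 <= s2 -> t2 - t1 < r -> s2 - s1 < r ->
    (forall t s, t1 <= t <= t2 -> s1 <= s <= s2 ->
      is_derive s 1 (A t) (f t s) /\ is_derive t 1 (B^~ s) (w t s)) ->
    `|circulation A B t1 t2 s1 s2 - kappa * (t2 - t1) * (s2 - s1)|
      <= e * (t2 - t1 + (s2 - s1)) ^+ 2.
Proof.
move=> [G [Gt [Gs HG]]] e e0.
have e20 : 0 < e / 2 by lra.
have [r r0 Hr] := HG _ e20; exists r => // A B t1 t2 s1 s2 ht hs tr sr dAB.
set L := t2 - t1 + (s2 - s1).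
have Hd t s : t1 <= t <= t2 -> s1 <= s <= s2 ->
  [/\ `|t - t0| < r, `|s - s0| < r & `|t - t0| + `|s - s0| <= L].
  move=> ht' hs'; have : `|t - t0| <= t2 - t1 by rewrite ler_norml; lra.
  have : `|s - s0| <= s2 - s1 by rewrite ler_norml; lra.
  by rewrite /L => ? ?; split; lra.
have HA t : t1 <= t <= t2 ->
  `|(A t s2 - G t s2 - kappa * (t - t0) * s2)
    - (A t s1 - G t s1 - kappa * (t - t0) * s1)| <= e / 2 * L * (s2 - s1).
  move=> ht'.
  apply: (@mean_value_le R (fun s => A t s - G t s - kappa * (t - t0) * s)
    (fun s => f t s - Gs t s - kappa * (t - t0))).
  - by lra.
  - move=> s hs'; have [h1 h2 _] := Hd _ _ ht' hs'.
    have [GsD _ _ _] := Hr _ _ h1 h2; have [AD _] := dAB _ _ ht' hs'.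
    apply: is_derive_eq; rewrite /GRing.scale/=; lra.
  - move=> s hs'; have [h1 h2 h3] := Hd _ _ ht' hs'.
    have [_ _ h4 _] := Hr _ _ h1 h2; apply: (le_trans h4).
    by rewrite ler_wpM2l// ltW.
have HB s : s1 <= s <= s2 ->
  `|(B t2 s - G t2 s) - (B t1 s - G t1 s)| <= e / 2 * L * (t2 - t1).
  move=> hs'.
  apply: (@mean_value_le R (fun t => B t s - G t s) (fun t => w t s - Gt t s)).
  - by lra.
  - move=> t ht'; have [h1 h2 _] := Hd _ _ ht' hs'.
    have [_ GtD _ _] := Hr _ _ h1 h2; have [_ BD] := dAB _ _ ht' hs'.
    exact: is_derive_eq.
  - move=> t ht'; have [h1 h2 h3] := Hd _ _ ht' hs'.
    have [_ _ _ h4] := Hr _ _ h1 h2; apply: (le_trans h4).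
    by rewrite ler_wpM2l// ltW.
have := HA t1; have := HA t2; have := HB s1; have := HB s2.
rewrite !lexx.
do 4! (move=> /(_ ltac:(lra)); rewrite ler_norml => /andP[? ?]).
rewrite /circulation ler_norml;
  have -> : e * L ^+ 2 = 2 * (e / 2 * L * (s2 - s1)) + 2 * (e / 2 * L * (t2 - t1)).
  by rewrite /L; field.
by lra.
Qed.

Lemma curl_exact (R : realType) (f w V : R -> R -> R) (kappa t0 s0 : R) :
  curl_at f w kappa t0 s0 ->
  (exists2 r : R, 0 < r & forall t s, `|t - t0| < r -> `|s - s0| < r ->
    is_derive s 1 (V t) (f t s) /\ is_derive t 1 (V^~ s) (w t s)) -> kappa = 0.
Proof.
move=> ck [r1 r10 HV]; apply/eqP; rewrite -normr_le0; apply/ler_addgt0Pr => e e0.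
have e40 : 0 < e / 4 by lra.
have [r2 r20 Hr] := curl_at_circulation ck e40.
have [h [h0 h1 h2]] : exists h : R, [/\ 0 < h, h < r1 & h < r2].
  by exists (Num.min r1 r2 / 2); case: (leP r1 r2) => ?; split; lra.
have [Et Es] : t0 + h - t0 = h /\ s0 + h - s0 = h by split; ring.
have := Hr V V t0 (t0 + h) s0 (s0 + h).
rewrite !lexx /= !lerDl (ltW h0) Et Es h2 => /(_ erefl erefl erefl erefl).
have -> : circulation V V t0 (t0 + h) s0 (s0 + h) = 0 by rewrite /circulation; ring.
have HV' t s : t0 <= t <= t0 + h -> s0 <= s <= s0 + h ->
    is_derive s 1 (V t) (f t s) /\ is_derive t 1 (V^~ s) (w t s).
  by move=> ht hs; apply: HV; rewrite ltr_norml; lra.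
move=> /(_ HV'); rewrite sub0r normrN !normrM. rewrite (gtr0_norm h0) => H.
have : `|kappa| * (h * h) <= e * (h * h) by rewrite mulrA; apply: le_trans H _;
  rewrite expr2; lra.
by rewrite ler_pM2r ?mulr_gt0// add0r.
Qed.

Lemma quarter_circulation (R : realType) (A B : R -> R -> R) (a b t s : R) :
  0 <= a -> 0 <= b -> exists p : R * R,
  [/\ t <= p.1 <= t + a / 2, s <= p.2 <= s + b / 2
    & `|circulation A B t (t + a) s (s + b)|
      <= 4 * `|circulation A B p.1 (p.1 + a / 2) p.2 (p.2 + b / 2)|].
Proof.
move=> a0 b0; set C := circulation A B.
set c := `|C t (t + a) s (s + b)|.
have E : C t (t + a) s (s + b) =
  C t (t + a / 2) s (s + b / 2) + C (t + a / 2) (t + a / 2 + a / 2) s (s + b / 2)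
  + (C t (t + a / 2) (s + b / 2) (s + b / 2 + b / 2)
  + C (t + a / 2) (t + a / 2 + a / 2) (s + b / 2) (s + b / 2 + b / 2)).
  have -> : t + a / 2 + a / 2 = t + a by field.
  have -> : s + b / 2 + b / 2 = s + b by field.
  by rewrite /C /circulation; ring.
apply: contrapT => /forallNP N.
have H (p : R * R) : t <= p.1 <= t + a / 2 -> s <= p.2 <= s + b / 2 ->
    `|C p.1 (p.1 + a / 2) p.2 (p.2 + b / 2)| < c / 4.
  move=> h1 h2; have := N p; rewrite h1 h2 ltNge => M; apply/negP => M'.
  by apply: M; split => //; rewrite -/C -/c; lra.
have := H (t, s) ltac:(rewrite /=; lra) ltac:(rewrite /=; lra).
have := H (t + a / 2, s) ltac:(rewrite /=; lra) ltac:(rewrite /=; lra).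
have := H (t, s + b / 2) ltac:(rewrite /=; lra) ltac:(rewrite /=; lra).
have := H (t + a / 2, s + b / 2) ltac:(rewrite /=; lra) ltac:(rewrite /=; lra).
rewrite /=.
have : c <= `|C t (t + a / 2) s (s + b / 2)|
   + `|C (t + a / 2) (t + a / 2 + a / 2) s (s + b / 2)|
  + (`|C t (t + a / 2) (s + b / 2) (s + b / 2 + b / 2)|
  + `|C (t + a / 2) (t + a / 2 + a / 2) (s + b / 2) (s + b / 2 + b / 2)|).
  by rewrite /c E; apply: le_trans (ler_normD _ _) _; apply: lerD; apply: ler_normD.
by lra.
Qed.

Lemma nested_point (R : realType) (x : nat -> R) (a : R) : 0 <= a ->
  (forall n, x n <= x n.+1 <= x n + a / 2 ^+ n.+1) ->
  exists l, forall n, x n <= l <= x n + a / 2 ^+ n.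
Proof.
move=> a0 hx.
have mono m n : (m <= n)%N -> x m <= x n.
  move=> /subnK <-; elim: (n - m)%N => // k IH.
  by rewrite addSn; apply: le_trans IH _; have /andP[] := hx (k + m)%N.
have anti m n : (m <= n)%N -> x n + a / 2 ^+ n <= x m + a / 2 ^+ m.
  move=> /subnK <-; elim: (n - m)%N => // k IH.
  rewrite addSn; apply: le_trans _ IH; have /andP[_ h] := hx (k + m)%N.
  apply: le_trans (lerD h (lexx _)) _; rewrite -addrA lerD2l exprS.
  have : 2 ^+ (k + m) != 0 :> R by rewrite expf_neq0.
  set y := 2 ^+ _ => y0; rewrite le_eqVlt; apply/orP; left; apply/eqP; field.
  by rewrite y0.
have ub n m : x m <= x n + a / 2 ^+ n.
  apply: le_trans (mono m (maxn m n) (leq_maxl _ _)) _.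
  apply: le_trans _ (anti n (maxn m n) (leq_maxr _ _)).
  by rewrite lerDl divr_ge0.
exists (sup (range x)) => n; apply/andP; split.
  apply: ub_le_sup; last by exists n.
  by exists (x 0%N + a / 2 ^+ 0) => _ [m _ <-].
by apply: ge_sup; [exists (x 0%N); exists 0%N | move=> _ [m _ <-]].
Qed.

(* Goursat's argument: a rectangle whose circulation is [c] contains a quarter
   with circulation at least [c / 4] in absolute value, and so on; this
   contradicts [curl_at_circulation] at the limit point unless [c = 0]. *)
Lemma goursat (R : realType) (f w A B : R -> R -> R) (t1 t2 s1 s2 : R) :
  t1 <= t2 -> s1 <= s2 ->
  (forall t s, t1 <= t <= t2 -> s1 <= s <= s2 ->
    [/\ is_derive s 1 (A t) (f t s), is_derive t 1 (B^~ s) (w t s)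
      & curl_at f w 0 t s]) ->
  circulation A B t1 t2 s1 s2 = 0.
Proof.
move=> t12 s12 H; set a := t2 - t1; set b := s2 - s1.
have a0 : 0 <= a by rewrite subr_ge0.
have b0 : 0 <= b by rewrite subr_ge0.
pose C (n : nat) (p : R * R) := `|circulation A B p.1 (p.1 + a / 2 ^+ n) p.2 (p.2 +
  b / 2 ^+ n)|.
have an n : 0 <= a / 2 ^+ n by rewrite divr_ge0.
have bn n : 0 <= b / 2 ^+ n by rewrite divr_ge0.
have halve n (x : R) : x / 2 ^+ n / 2 = x / 2 ^+ n.+1 by rewrite exprSr invfM mulrA.
have step (np : nat * (R * R)) : exists q : R * R,
    [/\ np.2.1 <= q.1 <= np.2.1 + a / 2 ^+ np.1.+1,
        np.2.2 <= q.2 <= np.2.2 + b / 2 ^+ np.1.+1 & C np.1 np.2 <= 4 * C np.1.+1 q].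
  case: np => n p /=.
  by have := @quarter_circulation R A B _ _ p.1 p.2 (an n) (bn n); rewrite !halve.
have [g gP] := choice step.
pose p := fix p n := if n is m.+1 then g (m, p m) else (t1, s1).
have [lt Hlt] := @nested_point R (fun n => (p n).1) a a0
  (fun n => let: And3 h _ _ := gP (n, p n) in h).
have [ls Hls] := @nested_point R (fun n => (p n).2) b b0
  (fun n => let: And3 _ h _ := gP (n, p n) in h).
have inn n : t1 <= (p n).1 /\ (p n).1 + a / 2 ^+ n <= t2
   /\ s1 <= (p n).2 /\ (p n).2 + b / 2 ^+ n <= s2.
  elim: n => [|n [h1 [h2 [h3 h4]]]] /=; first by rewrite expr0 !divr1 /a /b; lra.
  have [/= g1 g2 _] := gP (n, p n).
  by move: g1 g2 h2 h4; rewrite -!halve; lra.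
have Cn n : C 0%N (t1, s1) <= 4 ^+ n * C n (p n).
  elim: n => [|n IH]; first by rewrite expr0 mul1r.
  have [_ _ /= h] := gP (n, p n); apply: (le_trans IH).
  rewrite exprSr -mulrA ler_wpM2l // ?exprn_ge0 //.
have lin : t1 <= lt <= t2 /\ s1 <= ls <= s2.
  by have := Hlt 0%N; have := Hls 0%N; rewrite /= expr0 !divr1 /a /b; lra.
have [_ _ curl0] := H _ _ lin.1 lin.2.
have C0 : C 0%N (t1, s1) = `|circulation A B t1 t2 s1 s2|.
  by rewrite /C /= expr0 !divr1 ![_ + (_ - _)]addrC !subrK.
apply/eqP; rewrite -normr_le0 -C0; apply/ler_addgt0Pr => e e0.
have E0 : 0 < e / (1 + (a + b) ^+ 2).
  by rewrite divr_gt0// ltr_pwDl// sqr_ge0.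
have [r r0 Hr] := curl_at_circulation curl0 E0.
have [n hn] : exists n, (a + b) / 2 ^+ n < r.
  have [n hn] : exists n : nat, (a + b) / r < n%:R.
    exists (Num.bound ((a + b) / r)); apply: archi_boundP.
    by apply: divr_ge0; [exact: addr_ge0|exact: ltW].
  exists n; rewrite ltr_pdivrMr ?exprn_gt0// mulrC -ltr_pdivrMr//.
  apply: lt_le_trans hn _; rewrite -natrX ler_nat; exact: ltnW (ltn_expl _ _).
have [h1 [h2 [h3 h4]]] := inn n.
have an_n := an n; have bn_n := bn n.
have hab : a / 2 ^+ n + b / 2 ^+ n < r by rewrite -mulrDl.
have dAB t s : (p n).1 <= t <= (p n).1 + a / 2 ^+ n ->
    (p n).2 <= s <= (p n).2 + b / 2 ^+ n ->
    is_derive s 1 (A t) (f t s) /\ is_derive t 1 (B^~ s) (w t s).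
  move=> ht hs; have ht' : t1 <= t <= t2 by move: ht h1 h2; lra.
  have hs' : s1 <= s <= s2 by move: hs h3 h4; lra.
  by have [] := H t s ht' hs'.
have Hn : C n (p n) <= e / (1 + (a + b) ^+ 2) * ((a + b) / 2 ^+ n) ^+ 2.
  have E (x y : R) : x + y - x = y by ring.
  have := Hr A B _ _ _ _ (Hlt n) (Hls n) ltac:(move: hab; lra) ltac:(move: hab; lra) dAB.
  by rewrite !E !mul0r subr0 -mulrDl.
rewrite add0r; apply: le_trans (Cn n) _.
have y0 : 2 ^+ n != 0 :> R by rewrite expf_neq0.
apply: le_trans (ler_wpM2l _ Hn) _; first by rewrite exprn_ge0.
have -> : 4 ^+ n = (2 ^+ n) ^+ 2 :> R by rewrite -exprM mulnC exprM;
  congr (_ ^+ _); rewrite expr2; ring.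
have -> : (2 ^+ n) ^+ 2 * (e / (1 + (a + b) ^+ 2) * ((a + b) / 2 ^+ n) ^+ 2) =
  e * ((a + b) ^+ 2 / (1 + (a + b) ^+ 2)).
  by field; rewrite y0 gt_eqF// ltr_pwDl// sqr_ge0.
by rewrite ger_pMr// ler_pdivrMr ?mul1r ?lerDr// ltr_pwDl// sqr_ge0.
Qed.

Lemma nbhs_pairP (R : realType) (t0 s0 : R) (P : R * R -> Prop) :
  (\forall x \near (t0, s0), P x) -> exists2 r : R, 0 < r &
  forall t s, `|t - t0| < r -> `|s - s0| < r -> P (t, s).
Proof.
move=> /nbhs_ballP[r /= r0 H]; exists r => // t s ht hs.
by apply: H; split; rewrite /ball /= distrC.
Qed.

Lemma diff_approx (R : realType) (V W : normedModType R) (a : V -> W) (x0 : V) (e : R) :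
  differentiable a x0 -> 0 < e ->
  \forall x \near x0, `|a x - a x0 - 'd a x0 (x - x0)| <= e * `|x - x0|.
Proof.
move=> da e0; rewrite (near_shift 0 x0).
have /eqaddoP/(_ _ e0) := diff_locally da.
apply: filterS => h /=; rewrite subr0 addrK.
by rewrite opprD addrA.
Qed.

Lemma is_diff_approx (R : realType) (V W : normedModType R) (a : V -> W)
    (L : {linear V -> W}) (x0 : V) : continuous L ->
  (forall e : R, 0 < e ->
    \forall x \near x0, `|a x - a x0 - L (x - x0)| <= e * `|x - x0|) ->
  is_diff x0 a L.
Proof.
move=> cL H.
have E : a \o shift x0 = cst (a x0) + L +o_ 0 id.
  apply/eqaddoP => e e0; have := H e e0; rewrite (near_shift 0 x0).
  apply: filterS => h /=; rewrite subr0 addrK.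
  by rewrite opprD addrA.
have dL := diff_unique cL E.
by apply: DiffDef => //; apply/diff_locallyP; rewrite dL.
Qed.

Lemma diff_prodE (R : realType) (a : R * R -> R) (x : R * R) (t s : R) :
  'd a x (t, s) = t * 'd a x (1, 0) + s * 'd a x (0, 1).
Proof.
have -> : (t, s) = t *: (1, 0) + s *: (0, 1) :> R * R.
  apply: injective_projections; rewrite /= /GRing.scale /=; ring.
by rewrite linearD !linearZ.
Qed.

Lemma curl_at_mul (R : realType) (a b bt bs : R * R -> R) (t0 s0 : R) :
  differentiable a (t0, s0) ->
  {for (t0, s0), continuous bt} -> {for (t0, s0), continuous bs} ->
  (\forall x \near (t0, s0), is_derive (x.1 : R) 1 (fun t => b (t, x.2)) (bt x) /\
    is_derive (x.2 : R) 1 (fun s => b (x.1, s)) (bs x)) ->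
  curl_at (fun t s => a (t, s) * bs (t, s)) (fun t s => a (t, s) * bt (t, s))
    ('d a (t0, s0) (1, 0) * bs (t0, s0) - 'd a (t0, s0) (0, 1) * bt (t0, s0)) t0 s0.
Proof.
set x0 := (t0, s0) => da ct cs db.
set at_ := 'd a x0 (1, 0); set as_ := 'd a x0 (0, 1).
exists (fun t s => a x0 * b (t, s) + (as_ * bs x0 * (s - s0) ^+ 2 / 2
  + as_ * bt x0 * (t - t0) * (s - s0) + at_ * bt x0 * (t - t0) ^+ 2 / 2)).
exists (fun t s => a x0 * bt (t, s) + (at_ * (t - t0) + as_ * (s - s0)) * bt x0).
exists (fun t s => a x0 * bs (t, s) + (as_ * bs x0 * (s - s0) + as_ * bt x0 * (t - t0))).
move=> e e0.
pose L := `|at_| + `|as_|; pose M := `|bs x0| + `|bt x0| + 1.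
have LM : 0 < L + M by rewrite /L /M !addrA ltr_wpDl// !addr_ge0.
have [e1 [e10 e11 e1e]] : exists e1 : R, [/\ 0 < e1, e1 <= 1 & e1 * (L + M) <= e].
  exists (Num.min 1 (e / (L + M))); split.
  - by rewrite lt_min ltr01 divr_gt0.
  - by rewrite ge_min lexx.
  - by rewrite -ler_pdivlMr// ge_min lexx orbT.
have [r r0 H] : exists2 r : R, 0 < r & forall t s, `|t - t0| < r -> `|s - s0| < r ->
    [/\ is_derive t 1 (fun t => b (t, s)) (bt (t, s)),
        is_derive s 1 (fun s => b (t, s)) (bs (t, s)),
        `|a (t, s) - a x0 - 'd a x0 ((t, s) - x0)| <= e1 * `|(t, s) - x0|,
        `|bt x0 - bt (t, s)| <= e1 & `|bs x0 - bs (t, s)| <= e1].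
  apply: (@nbhs_pairP R t0 s0 (fun x => [/\ is_derive (x.1 : R) 1 (fun t => b (t,
    x.2)) (bt x),
        is_derive (x.2 : R) 1 (fun s => b (x.1, s)) (bs x),
        `|a x - a x0 - 'd a x0 (x - x0)| <= e1 * `|x - x0|,
        `|bt x0 - bt x| <= e1 & `|bs x0 - bs x| <= e1])).
  near=> x.
  have [db1 db2] : is_derive (x.1 : R) 1 (fun t => b (t, x.2)) (bt x) /\
    is_derive (x.2 : R) 1 (fun s => b (x.1, s)) (bs x) by near: x.
  have h1 : `|bt x0 - bt x| <= e1 by near: x; move/cvgrPdist_le : ct; apply.
  have h2 : `|bs x0 - bs x| <= e1 by near: x; move/cvgrPdist_le : cs; apply.
  have h3 : `|a x - a x0 - 'd a x0 (x - x0)| <= e1 * `|x - x0|.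
    by near: x; have := diff_approx da e10.
  by [].
exists r => // t s tr sr; have [bD1 bD2 h1 h2 h3] := H t s tr sr.
set n := `|t - t0| + `|s - s0|.
have n0 : 0 <= n by rewrite addr_ge0.
have {}h1 : `|a (t, s) - a x0 - (at_ * (t - t0) + as_ * (s - s0))| <= e1 * n.
  move: h1; rewrite -[(t, s) - x0]/(t - t0, s - s0) diff_prodE -/at_ -/as_.
  rewrite [(t - t0) * _]mulrC [(s - s0) * _]mulrC => /le_trans; apply.
  rewrite ler_pM2l// prod_normE /= ge_max /n lerDl lerDr !normr_ge0 //.
have lin : `|at_ * (t - t0) + as_ * (s - s0)| <= L * n.
  apply: le_trans (ler_normD _ _) _; rewrite !normrM /L /n.
  have := normr_ge0 at_; have := normr_ge0 as_; have := normr_ge0 (t - t0);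
    have := normr_ge0 (s - s0).
  nra.
have main (y y0 : R) : `|y0 - y| <= e1 -> `|y0| + 1 <= M ->
    `|(a (t, s) - a x0) * y - (at_ * (t - t0) + as_ * (s - s0)) * y0| <= e * n.
  move=> hy hM.
  have -> : (a (t, s) - a x0) * y - (at_ * (t - t0) + as_ * (s - s0)) * y0 =
    (a (t, s) - a x0 - (at_ * (t - t0) + as_ * (s - s0))) * y
    - (at_ * (t - t0) + as_ * (s - s0)) * (y0 - y) by ring.
  apply: le_trans (ler_normB _ _) _; rewrite !normrM.
  have yM : `|y| <= M.
    apply: le_trans hM; rewrite -(subrK y0 y) addrC.
    by apply: le_trans (ler_normD _ _) _; rewrite lerD2l distrC (le_trans hy).
  apply: (@le_trans _ _ (e1 * n * M + L * n * e1)).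
    by apply: lerD; apply: ler_pM.
  have -> : e1 * n * M + L * n * e1 = e1 * (L + M) * n by ring.
  exact: ler_wpM2r.
have dsub (c x : R) : is_derive x 1 (fun y : R => y - c) 1.
  by apply: is_derive_eq; rewrite subr0.
have dsqr (c x : R) : is_derive x 1 (fun y : R => (y - c) ^+ 2) (2 * (x - c)).
  apply: is_derive_eq; rewrite /GRing.scale/=; ring.
have dlin (f : R -> R) (df c x : R) : is_derive x 1 f df ->
  is_derive x 1 (fun y : R => c * f y) (c * df).
  by move=> fD; apply: is_derive_eq.
split.
- have D1 := dlin _ _ (a x0) _ bD2.
  have D2 := dlin _ _ (as_ * bs x0 / 2) _ (dsqr s0 s).
  have D3 := dlin _ _ (as_ * bt x0 * (t - t0)) _ (dsub s0 s).
  have -> : (fun s => a x0 * b (t, s) + (as_ * bs x0 * (s - s0) ^+ 2 / 2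
     + as_ * bt x0 * (t - t0) * (s - s0) + at_ * bt x0 * (t - t0) ^+ 2 / 2)) =
    (fun s => a x0 * b (t, s)) + (fun s => as_ * bs x0 / 2 * (s - s0) ^+ 2)
    + (fun s => as_ * bt x0 * (t - t0) * (s - s0)) + cst (at_ * bt x0 * (t - t0) ^+
      2 / 2).
    by apply/funext => y; rewrite !fctE; field.
  by apply: is_derive_eq; field.
- have D1 := dlin _ _ (a x0) _ bD1.
  have D2 := dlin _ _ (at_ * bt x0 / 2) _ (dsqr t0 t).
  have D3 := dlin _ _ (as_ * bt x0 * (s - s0)) _ (dsub t0 t).
  have -> : (fun t => a x0 * b (t, s) + (as_ * bs x0 * (s - s0) ^+ 2 / 2
     + as_ * bt x0 * (t - t0) * (s - s0) + at_ * bt x0 * (t - t0) ^+ 2 / 2)) =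
    (fun t => a x0 * b (t, s)) + (fun t => at_ * bt x0 / 2 * (t - t0) ^+ 2)
    + (fun t => as_ * bt x0 * (s - s0) * (t - t0)) + cst (as_ * bs x0 * (s - s0) ^+
      2 / 2).
    by apply/funext => y; rewrite !fctE; field.
  by apply: is_derive_eq; field.
- have -> : a (t, s) * bs (t, s) - (a x0 * bs (t, s)
       + (as_ * bs x0 * (s - s0) + as_ * bt x0 * (t - t0)))
       - (at_ * bs x0 - as_ * bt x0) * (t - t0) =
     (a (t, s) - a x0) * bs (t, s) - (at_ * (t - t0) + as_ * (s - s0)) * bs x0 by ring.
  by apply: main => //; rewrite /M; have := normr_ge0 (bt x0); lra.
- have -> : a (t, s) * bt (t, s) - (a x0 * bt (t, s)
       + (at_ * (t - t0) + as_ * (s - s0)) * bt x0) =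
     (a (t, s) - a x0) * bt (t, s) - (at_ * (t - t0) + as_ * (s - s0)) * bt x0 by ring.
  by apply: main => //; rewrite /M; have := normr_ge0 (bs x0); lra.
Unshelve. all: by end_near. Qed.

Lemma curl_at0 (R : realType) (t0 s0 : R) :
  curl_at (fun _ _ => 0) (fun _ _ => 0) 0 t0 s0.
Proof.
exists (fun _ _ => 0), (fun _ _ => 0), (fun _ _ => 0) => e e0.
exists 1 => // t s _ _; split; try exact: is_derive_cst.
- by rewrite mul0r !subr0 normr0 mulr_ge0 ?addr_ge0// ltW.
- by rewrite subr0 normr0 mulr_ge0 ?addr_ge0// ltW.
Qed.

Lemma curl_atD (R : realType) (f1 w1 f2 w2 : R -> R -> R) (k1 k2 t0 s0 : R) :
  curl_at f1 w1 k1 t0 s0 -> curl_at f2 w2 k2 t0 s0 ->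
  curl_at (fun t s => f1 t s + f2 t s) (fun t s => w1 t s + w2 t s) (k1 + k2) t0 s0.
Proof.
move=> [G1 [Gt1 [Gs1 H1]]] [G2 [Gt2 [Gs2 H2]]].
exists (fun t s => G1 t s + G2 t s), (fun t s => Gt1 t s + Gt2 t s),
  (fun t s => Gs1 t s + Gs2 t s) => e e0.
have e20 : 0 < e / 2 by rewrite divr_gt0.
have [r1 r10 {}H1] := H1 _ e20; have [r2 r20 {}H2] := H2 _ e20.
exists (Num.min r1 r2); first by rewrite lt_min r10.
move=> t s; rewrite !lt_min => /andP[tr1 tr2] /andP[sr1 sr2].
have [D1 D2 D3 D4] := H1 t s tr1 sr1; have [E1 E2 E3 E4] := H2 t s tr2 sr2.
have -> : e * (`|t - t0| + `|s - s0|) =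
  e / 2 * (`|t - t0| + `|s - s0|) + e / 2 * (`|t - t0| + `|s - s0|) by field.
split.
- exact: is_deriveD.
- exact: (@is_deriveD _ _ _ (G1^~ s) (G2^~ s)).
- apply: le_trans (lerD D3 E3); apply: le_trans _ (ler_normD _ _).
  by rewrite le_eqVlt; apply/orP; left; apply/eqP; congr (`|_|); ring.
- apply: le_trans (lerD D4 E4); apply: le_trans _ (ler_normD _ _).
  by rewrite le_eqVlt; apply/orP; left; apply/eqP; congr (`|_|); ring.
Qed.

Lemma curl_at_sum (R : realType) (n : nat) (f w : 'I_n -> R -> R -> R) (k : 'I_n ->
  R) (t0 s0 : R) :
  (forall i, curl_at (f i) (w i) (k i) t0 s0) ->
  curl_at (fun t s => \sum_i f i t s) (fun t s => \sum_i w i t s) (\sum_i k i) t0 s0.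
Proof.
move=> H; elim: n f w k H => [|n IH] f w k H.
  have -> : (fun t s => \sum_(i < 0) f i t s) = fun _ _ => 0.
    by apply/funext => t; apply/funext => s; rewrite big_ord0.
  have -> : (fun t s => \sum_(i < 0) w i t s) = fun _ _ => 0.
    by apply/funext => t; apply/funext => s; rewrite big_ord0.
  by rewrite big_ord0; exact: curl_at0.
have -> : (fun t s => \sum_(i < n.+1) f i t s) =
    fun t s => f ord0 t s + \sum_(i < n) f (lift ord0 i) t s.
  by apply/funext => t; apply/funext => s; rewrite big_ord_recl.
have -> : (fun t s => \sum_(i < n.+1) w i t s) =
    fun t s => w ord0 t s + \sum_(i < n) w (lift ord0 i) t s.
  by apply/funext => t; apply/funext => s; rewrite big_ord_recl.
by rewrite big_ord_recl; apply: curl_atD => //; apply: IH.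
Qed.

Lemma mean_value_ball (R : realType) (f df : R -> R) (x y M : R) :
  (forall z, `|z - x| <= `|y - x| -> is_derive z 1 f (df z) /\ `|df z| <= M) ->
  `|f y - f x| <= M * `|y - x|.
Proof.
move=> H; have [xy|/ltW yx] := leP x y.
  rewrite (ger0_norm (_ : 0 <= y - x)) ?subr_ge0//.
  apply: (@mean_value_le R f df) => // z /andP[xz zy];
    have [|//] := H z; by rewrite !ger0_norm ?subr_ge0// lerD2r.
rewrite distrC [`|y - x|]distrC (ger0_norm (_ : 0 <= x - y)) ?subr_ge0//.
apply: (@mean_value_le R f df) => // z /andP[yz zx];
  have [|//] := H z; by rewrite [`|z - x|]distrC [`|y - x|]distrC !ger0_norm
    ?subr_ge0// lerD2l lerN2.
Qed.

Lemma is_derive_approx (R : realType) (f : R -> R) (df x0 e : R) :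
  is_derive x0 1 f df -> 0 < e ->
  \forall x \near x0, `|f x - f x0 - df * (x - x0)| <= e * `|x - x0|.
Proof.
move=> fD e0; have fx : derivable f x0 1 by [].
have := diff_approx (iffLR (derivable1_diffP _ _) fx) e0.
apply: filterS => x; rewrite deriv1E//= derive1E derive_val.
by rewrite /GRing.scale /= mulrC.
Qed.

Lemma differentiable_partial (R : realType) (a ds : R * R -> R) (t0 s0 dt : R) :
  is_derive t0 1 (fun t => a (t, s0)) dt -> {for (t0, s0), continuous ds} ->
  (\forall x \near (t0, s0), is_derive (x.2 : R) 1 (fun s => a (x.1, s)) (ds x)) ->
  [/\ differentiable a (t0, s0), 'd a (t0, s0) (1, 0) = dt
    & 'd a (t0, s0) (0, 1) = ds (t0, s0)].
Proof.
move=> aDt cds aDs; set x0 := (t0, s0).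
pose l (x : R * R) := dt * x.1 + ds x0 * x.2.
have l_lin : linear l.
  by move=> k x y; rewrite /l /= /GRing.scale /=; ring.
pose lM := GRing.isLinear.Build _ _ _ _ _ l_lin.
pose L : {linear (R * R)%type -> R} := HB.pack l lM.
have cL : continuous L.
  move=> x; apply: cvgD; apply: cvgM; try exact: cvg_cst.
    exact: cvg_fst.
  exact: cvg_snd.
have dL : is_diff x0 a L.
  apply: is_diff_approx => // e e0.
  have e20 : 0 < e / 2 by rewrite divr_gt0.
  have [r r0 H] : exists2 r : R, 0 < r & forall t s, `|t - t0| < r -> `|s - s0| < r ->
      [/\ is_derive s 1 (fun s => a (t, s)) (ds (t, s)), `|ds (t, s) - ds x0| <= e / 2
        & `|a (t, s0) - a x0 - dt * (t - t0)| <= e / 2 * `|t - t0|].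
    apply: (@nbhs_pairP R t0 s0 (fun x =>
      [/\ is_derive (x.2 : R) 1 (fun s => a (x.1, s)) (ds x), `|ds x - ds x0| <= e / 2
        & `|a (x.1, s0) - a x0 - dt * (x.1 - t0)| <= e / 2 * `|x.1 - t0|])).
    near=> x; split.
    + by near: x.
    + by rewrite distrC; near: x; move/cvgrPdist_le : cds; apply.
    + near: x; have /nbhs_ballP[q /= q0 hq] := is_derive_approx aDt e20.
      by apply/nbhs_ballP; exists q => //= -[t s] [/= h _]; exact: hq.
  apply/nbhs_ballP; exists r => //= -[t s] [].
  rewrite /ball /= distrC => tr; rewrite distrC => sr.
  have [_ _ h3] := H t s tr sr.
  rewrite /= /l /=.
  have h4 : `|(a (t, s) - ds x0 * s) - (a (t, s0) - ds x0 * s0)| <= e / 2 * `|s - s0|.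
    apply: (@mean_value_ball R (fun s => a (t, s) - ds x0 * s) (fun s => ds (t,
      s) - ds x0)).
    move=> z zs; have [D1 D2 _] := H t z tr (le_lt_trans zs sr).
    split => //.
    have D3 : is_derive z 1 (fun s => ds x0 * s) (ds x0 * 1).
      by apply: is_derive_eq; rewrite /GRing.scale/= mulr1.
    by apply: is_derive_eq; rewrite mulr1.
  have -> : a (t, s) - a x0 - (dt * (t - t0) + ds x0 * (s - s0)) =
    ((a (t, s) - ds x0 * s) - (a (t, s0) - ds x0 * s0))
    + (a (t, s0) - a x0 - dt * (t - t0)) by ring.
  apply: le_trans (ler_normD _ _) _; apply: le_trans (lerD h4 h3) _.
  have -> : e * `|(t, s) - x0| = e / 2 * `|(t, s) - x0| + e / 2 * `|(t, s) - x0|.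
    by field.
  by apply: lerD; rewrite ler_pM2l// prod_normE /= le_max lexx ?orbT.
split; first exact: ex_diff.
- by rewrite diff_val /= /l /= mulr1 mulr0 addr0.
- by rewrite diff_val /= /l /= mulr1 mulr0 add0r.
Unshelve. all: by end_near. Qed.

Lemma exists_primitive (R : realType) (g : R -> R) (a b : R) :
  (forall t, a <= t <= b -> {for t, continuous g}) ->
  exists G : R -> R, forall t, a < t < b -> is_derive t 1 G (g t).
Proof.
move=> cg.
have ig : (@lebesgue_measure R).-integrable `[a, b] (EFin \o g).
  apply: continuous_compact_integrable; first exact: segment_compact.
  by apply: continuous_in_subspaceT => t /[!inE] /= /[!in_itv] /= ?; exact: cg.
exists (fun x => (\int[@lebesgue_measure R]_(t in [set` `[a,
  x]]) (g t))%R) => t /andP[at_ tb].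
have [] := @continuous_FTC1_closed R g a t b tb ig at_; first by apply: cg; rewrite !ltW.
by move=> h1 h2; apply: DeriveDef => //; rewrite -derive1E.
Qed.

Lemma derive_primitive (R : realType) (f w B : R -> R -> R) (t1 t2 s0 r : R) :
  0 < r -> t1 <= t2 ->
  (forall t s, t1 <= t <= t2 -> `|s - s0| < r ->
    [/\ {for s, continuous (f t)}, is_derive t 1 (B^~ s) (w t s) & curl_at f w 0 t s]) ->
  is_derive s0 1 (fun s => B t2 s - B t1 s) (f t2 s0 - f t1 s0).
Proof.
move=> r0 t12 H.
have Hs s : s0 - r / 2 <= s <= s0 + r / 2 -> `|s - s0| < r.
  by move=> hs; rewrite ltr_norml; lra.
have /choice[A HA] : forall t, exists A : R -> R, t1 <= t <= t2 ->
    forall s, s0 - r / 2 < s < s0 + r / 2 -> is_derive s 1 A (f t s).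
  move=> t; have [ht|ht] := boolP (t1 <= t <= t2); last by exists (fun=> 0).
  have cf s : s0 - r / 2 <= s <= s0 + r / 2 -> {for s, continuous (f t)}.
    by move=> hs; have [] := H t s ht (Hs s hs).
  by have [A HA] := exists_primitive cf; exists A.
have E s : s0 - r / 2 < s < s0 + r / 2 ->
    B t2 s - B t1 s = (B t2 s0 - B t1 s0) + ((A t2 s - A t2 s0) - (A t1 s - A t1 s0)).
  have main x y : x <= y -> s0 - r / 2 < x -> y < s0 + r / 2 ->
    circulation A B t1 t2 x y = 0.
    move=> xy hx hy; apply: (@goursat R f w) => // t s' ht hs.
    have hs' : s0 - r / 2 <= s' <= s0 + r / 2 by lra.
    have [_ h1 h2] := H t s' ht (Hs _ hs'); split => //.
    by apply: HA => //; lra.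
  move=> hs; have [ss0|/ltW ss0] := leP s s0.
    have := main s s0 ss0 ltac:(lra) ltac:(lra); rewrite /circulation; lra.
  have := main s0 s ss0 ltac:(lra) ltac:(lra); rewrite /circulation; lra.
have D : is_derive s0 1 (fun s =>
  (B t2 s0 - B t1 s0) + ((A t2 s - A t2 s0) - (A t1 s - A t1 s0)))
    (f t2 s0 - f t1 s0).
  have D2 : is_derive s0 1 (A t2) (f t2 s0) by apply: HA; lra.
  have D1 : is_derive s0 1 (A t1) (f t1 s0) by apply: HA; lra.
  have D := @is_deriveD _ _ _ _ _ _ _ _ _ (is_derive_cst (B t2 s0 - B t1 s0) s0 1)
    (@is_deriveB _ _ _ _ _ _ _ _ _ (@is_deriveB _ _ _ _ _ _ _ _ _ D2 (is_derive_cst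
      (A t2 s0) s0 1))
      (@is_deriveB _ _ _ _ _ _ _ _ _ D1 (is_derive_cst (A t1 s0) s0 1))).
  by apply: (is_derive_eq D); rewrite !subr0 add0r.
apply: near_eq_is_derive D; near=> s; rewrite -E//.
have : `|s - s0| < r / 2.
  near: s; apply/nbhs_ballP; exists (r / 2) => /=; first by rewrite divr_gt0.
  by move=> s; rewrite /ball /= distrC.
by rewrite ltr_norml; lra.
Unshelve. all: by end_near. Qed.

(** * The exact flow *)

Lemma continuous_sum_at (R : realType) (T : topologicalType) (n : nat) (F : 'I_n ->
  T -> R) (x : T) :
  (forall i, {for x, continuous (F i)}) ->
  {for x, continuous (fun y => \sum_i F i y)}.
Proof.
move=> H; elim: n F H => [|n IH] F H.
  rewrite (_ : (fun y => _) = cst 0); first exact: cst_continuous.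
  by apply/funext => y; rewrite big_ord0.
rewrite (_ : (fun y => _) = fun y => F ord0 y + \sum_(i < n) F (lift ord0 i) y).
  by apply: continuousD; [exact: H|apply: IH].
by apply/funext => y; rewrite big_ord_recl.
Qed.

Lemma is_derive_line (R : realType) (V W : normedModType R) (F : V ->
  W) (z u : V) (s : R) :
  differentiable F (z + s *: u) ->
  is_derive s 1 (fun s => F (z + s *: u)) ('d F (z + s *: u) u).
Proof.
move=> dF.
have dl : is_diff s (fun s : R => z + s *: u) (fun s => s *: u).
  have := @is_diffD R R V (cst z) ( *:%R^~ u) _ _ s (is_diff_cst z s)
    (is_diff_scalel s u).
  by rewrite (_ : 0 + _ = (fun s => s *: u)) //; apply/funext => x; rewrite !fctE add0r.
have dl' : differentiable (fun s : R => z + s *: u) s by apply: ex_diff.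
have dc : differentiable (F \o (fun s : R => z + s *: u)) s by exact: differentiable_comp.
apply: DeriveDef; first exact/derivable1_diffP.
by rewrite deriveE// diff_comp//= diff_val scale1r.
Qed.

Lemma is_diff_fst (R : realType) (x : R * R) : is_diff x (fst : R * R -> R) fst.
Proof.
have @f : {linear (R * R)%type -> R}.
  by exists (fst : R * R -> R); do 2![eexists]; do ?[constructor].
rewrite (_ : fst = f)//; apply: DiffDef.
  by apply: linear_differentiable => y; exact: cvg_fst.
by rewrite diff_lin// => y; exact: cvg_fst.
Qed.

Lemma is_diff_snd (R : realType) (x : R * R) : is_diff x (snd : R * R -> R) snd.
Proof.
have @f : {linear (R * R)%type -> R}.
  by exists (snd : R * R -> R); do 2![eexists]; do ?[constructor].
rewrite (_ : snd = f)//; apply: DiffDef.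
  by apply: linear_differentiable => y; exact: cvg_snd.
by rewrite diff_lin// => y; exact: cvg_snd.
Qed.

Lemma is_diff_plane (R : realType) (V : normedModType R) (z u v : V) (x : R * R) :
  is_diff x (fun x : R * R => z + x.1 *: u + x.2 *: v) (fun x => x.1 *: u + x.2 *: v).
Proof.
have e1 := @is_diff_comp _ _ _ _ _ _ _ _ _ (is_diff_fst x) (is_diff_scalel x.1 u).
have e2 := @is_diff_comp _ _ _ _ _ _ _ _ _ (is_diff_snd x) (is_diff_scalel x.2 v).
apply: (@is_diff_eq _ _ _ _ _ _ _ (@is_diffD _ _ _ _ _ _ _ _ (@is_diffD _ _ _ _ _ _
  _ _ (is_diff_cst z x) e1) e2)).
by apply/funext => y; rewrite !fctE add0r.
Qed.

Lemma differentiable_rV (R : realType) (V : normedModType R) (n : nat) (F : V ->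
  'rV[R]_n) (x : V) :
  (forall i, differentiable (fun y => F y ord0 i) x) -> differentiable F x.
Proof.
move=> H; rewrite (_ : F = \sum_i (fun y => F y ord0 i *: delta_mx ord0 i)).
  by apply: differentiable_sum => i; exact: differentiableZl.
by apply/funext => y; rewrite [LHS]row_sum_delta fct_sumE.
Qed.

Lemma diff_coord (R : realType) (V : normedModType R) (n : nat) (F : V ->
  'rV[R]_n) (x v : V) (i : 'I_n) :
  differentiable F x -> 'd (fun y => F y ord0 i) x v = 'd F x v ord0 i.
Proof.
move=> dF.
have @f : {linear 'rV[R]_n -> R}.
  by exists (fun N : 'rV[R]_n => N ord0 i); do 2![eexists]; do ?[constructor];
     rewrite ?mxE// => ? *; rewrite ?mxE//; move=> ?; rewrite !mxE.
have cf : continuous f by exact: coord_continuous.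
rewrite -[fun y => _]/(f \o F) diff_comp//; last exact: linear_differentiable.
by rewrite /= -[X in _ = X]/(f ('d F x v)) -(diff_lin (F x) cf).
Qed.

Lemma differentiable_coord_comp (R : realType) (V : normedModType R) (n : nat) (F :
  V -> 'rV[R]_n) (x : V) (i : 'I_n) :
  differentiable F x -> differentiable (fun y => F y ord0 i) x.
Proof.
by move=> dF; apply: (@differentiable_comp _ _ _ _ F (fun N => N ord0 i)) => //;
  exact: differentiable_coord.
Qed.

Lemma diff_grad (R : realType) (n : nat) (f : 'rV[R]_n -> R) (x v : 'rV[R]_n) :
  differentiable f x -> 'd f x v = \sum_i v ord0 i * grad f x ord0 i.
Proof.
move=> df; rewrite {1}[v]row_sum_delta linear_sum; apply: eq_bigr => i _.
by rewrite linearZ mxE deriveE.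
Qed.

Lemma curl_at_pullback (R : realType) (V : normedModType R) (A B : V -> R) (z u v : V) :
  differentiable A z -> (forall x, differentiable B x) ->
  {for z, continuous (fun x => 'd B x u)} -> {for z, continuous (fun x => 'd B x v)} ->
  curl_at (fun s t => A (z + s *: u + t *: v) * 'd B (z + s *: u + t *: v) v)
    (fun s t => A (z + s *: u + t *: v) * 'd B (z + s *: u + t *: v) u)
    ('d A z u * 'd B z v - 'd A z v * 'd B z u) 0 0.
Proof.
move=> dA dB cu cv.
have E0 : z + (0 : R) *: u + (0 : R) *: v = z by rewrite !scale0r !addr0.
have P := is_diff_plane z u v (0, 0).
have dP : differentiable (fun x : R * R => z + x.1 *: u + x.2 *: v) (0,
  0) by exact: ex_diff.
have dA' : differentiable A (z + (0 : R) *: u + (0 : R) *: v) by rewrite E0.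
have cP : {for (0, 0), continuous (fun x : R * R => z + x.1 *: u + x.2 *: v)}.
  exact: differentiable_continuous.
have := @curl_at_mul R (fun x => A (z + x.1 *: u + x.2 *: v)) (fun x =>
  B (z + x.1 *: u + x.2 *: v))
  (fun x => 'd B (z + x.1 *: u + x.2 *: v) u) (fun x =>
    'd B (z + x.1 *: u + x.2 *: v) v) 0 0.
rewrite /= !E0.
have -> : 'd (fun x : R * R => A (z + x.1 *: u + x.2 *: v)) (0,
  0) = 'd A z \o (fun x => x.1 *: u + x.2 *: v) :> (R * R -> R).
  have := @diff_comp _ _ _ _ (fun x : R * R => z + x.1 *: u + x.2 *: v) A (0, 0) dP dA'.
  by rewrite diff_val /= E0.
rewrite /= !scale1r !scale0r addr0 add0r; apply.
- exact: differentiable_comp.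
- apply: (@continuous_comp _ _ _ (fun x : R * R =>
  z + x.1 *: u + x.2 *: v) (fun y => 'd B y u)) => //.
  by rewrite /= E0.
- apply: (@continuous_comp _ _ _ (fun x : R * R =>
  z + x.1 *: u + x.2 *: v) (fun y => 'd B y v)) => //.
  by rewrite /= E0.
- near=> x; split.
    have -> : (fun t : R => B (z + t *: u + x.2 *: v)) = (fun t =>
      B (z + x.2 *: v + t *: u)).
      by apply/funext => t; rewrite addrAC.
    by rewrite addrAC; apply: is_derive_line.
  exact: is_derive_line.
Unshelve. all: by end_near. Qed.

Lemma diffM_at (R : realType) (V : normedModType R) (f g : V -> R) (x v : V) :
  differentiable f x -> differentiable g x ->
  'd (fun y => f y * g y) x v = f x * 'd g x v + g x * 'd f x v.
Proof. by move=> df dg; rewrite (_ : (fun y => _) = f * g)// diffM. Qed.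

Lemma diffD_at (R : realType) (V : normedModType R) (f g : V -> R) (x v : V) :
  differentiable f x -> differentiable g x ->
  'd (fun y => f y + g y) x v = 'd f x v + 'd g x v.
Proof. by move=> df dg; rewrite (_ : (fun y => _) = f + g)// diffD. Qed.

Lemma diff_comp_at (R : realType) (V1 V2 V3 : normedModType R) (f : V1 ->
  V2) (g : V2 -> V3) (x v : V1) :
  differentiable f x -> differentiable g (f x) ->
  'd (fun y => g (f y)) x v = 'd g (f x) ('d f x v).
Proof. by move=> df dg; rewrite (_ : (fun y => _) = g \o f)// diff_comp. Qed.

Definition friction_field (R : realType) (d : nat) (U K : 'rV[R]_d -> R) (c : R)
    (z : 'rV[R]_(d + d)) : 'rV[R]_(d + d) :=
  row_mx (grad K (ppart z)) (- grad U (qpart z) + c *: ppart z).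

Definition C1_solution (R : realType) (d : nat) (X : 'rV[R]_(d + d) -> 'rV[R]_(d + d))
    (a b : R) (Z : R -> 'rV[R]_(d + d) -> 'rV[R]_(d + d)) :=
  forall t z, a < t < b ->
    [/\ differentiable (Z t) z,
        {for (t, z), continuous (fun tz : R * 'rV[R]_(d + d) => Jac (Z tz.1) tz.2)}
      & forall k, is_derive t 1 (fun s => Z s z ord0 k) (X (Z t z) ord0 k)].

Lemma mulmx_Jac (R : realType) (n m : nat) (F : 'rV[R]_n -> 'rV[R]_m) (z u : 'rV[R]_n) :
  u *m (Jac F z)^T = 'd F z u.
Proof. by rewrite /Jac trmxK /jacobian mul_rV_lin1. Qed.

Lemma omegaE (R : realType) (d : nat) (Z : R -> 'rV[R]_(d + d) -> 'rV[R]_(d + d)) (t : R)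
    (z u v : 'rV[R]_(d + d)) : differentiable (Z t) z ->
  omega Z t z u v = \sum_(i < d)
    ('d (Z t) z u ord0 (lshift d i) * 'd (Z t) z v ord0 (rshift d i)
     - 'd (Z t) z v ord0 (lshift d i) * 'd (Z t) z u ord0 (rshift d i)).
Proof.
move=> dZ; apply: eq_bigr => i _; rewrite /wedge /dform.
have -> : (fun z0 => qpart (Z t z0) ord0 i) = fun z0 => Z t z0 ord0 (lshift d i).
  by apply/funext => y; rewrite mxE.
have -> : (fun z0 => ppart (Z t z0) ord0 i) = fun z0 => Z t z0 ord0 (rshift d i).
  by apply/funext => y; rewrite mxE.
by congr (_ * _ - _ * _); exact: diff_coord.
Qed.

Lemma continuous_diff_Jac (R : realType) (n m : nat) (T : topologicalType)
    (F : T -> 'rV[R]_n -> 'rV[R]_m) (g : T ->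
      'rV[R]_n) (x : T) (u : 'rV[R]_n) (k : 'I_m) :
  {for x, continuous (fun y => Jac (F y) (g y))} ->
  {for x, continuous (fun y => 'd (F y) (g y) u ord0 k)}.
Proof.
move=> cJ.
have -> : (fun y => 'd (F y) (g y) u ord0 k) = fun y =>
  \sum_j u ord0 j * Jac (F y) (g y) k j.
  apply/funext => y; rewrite -mulmx_Jac mxE; apply: eq_bigr => j _.
  by rewrite [in LHS]mxE.
apply: continuous_sum_at => j; apply: continuousM; first exact: cst_continuous.
by apply: (@continuous_comp _ _ _ _ (fun M : 'M[R]_(m, n) => M k j)) => //;
  exact: coord_continuous.
Qed.

Lemma near_itv (R : realType) (a b t : R) : a < t < b -> \forall x \near t, a < x < b.
Proof.
by move=> tab; have := near_in_itvoo (a := a) (b := b) (x := t); rewrite in_itv/=; apply.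
Qed.

Definition scaled_pullback (R : realType) (d : nat) (c : R)
    (Z : R -> 'rV[R]_(d + d) -> 'rV[R]_(d + d)) (u : 'rV[R]_(d + d)) (t : R)
    (z : 'rV[R]_(d + d)) : R :=
  \sum_(i < d) Z t z ord0 (lshift d i)
    * (expR (- c * t) * 'd (Z t) z u ord0 (rshift d i)).

Definition action_density (R : realType) (d : nat) (U K : 'rV[R]_d -> R) (c : R)
    (Z : R -> 'rV[R]_(d + d) -> 'rV[R]_(d + d)) (t : R) (z : 'rV[R]_(d + d)) : R :=
  \sum_(i < d) Z t z ord0 (lshift d i)
    * (- (expR (- c * t) * grad U (qpart (Z t z)) ord0 i))
  + expR (- c * t) * (U (qpart (Z t z)) + K (ppart (Z t z))).

Lemma is_derive_expRM (R : realType) (c t : R) :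
  is_derive t 1 (fun t : R => expR (- c * t)) (- c * expR (- c * t)).
Proof.
have h : is_derive t 1 (fun t : R => - c * t) (- c).
  have := @is_deriveZ R R R id (- c) t 1 1 _.
  rewrite /GRing.scale /= mulr1; apply; exact: is_derive_id.
apply: (is_derive_eq (is_derive1_comp (is_derive_expR _) h)).
by rewrite mulrC.
Qed.

Lemma flow_curl (R : realType) (d : nat) (U K : 'rV[R]_d -> R) (c a b : R)
    (Z : R -> 'rV[R]_(d + d) -> 'rV[R]_(d + d))
    (hU : forall q, differentiable U q) (cU : continuous (grad U))
    (hK : forall p, differentiable K p) (hZ : C1_solution (friction_field U K c) a b Z)
    (z u : 'rV[R]_(d + d)) (t0 s0 : R) : a < t0 < b ->
  curl_at (fun t s => scaled_pullback c Z u t (z + s *: u))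
    (fun t s => action_density U K c Z t (z + s *: u)) 0 t0 s0.
Proof.
move=> tab.
pose S (x : R * R) := Z x.1 (z + x.2 *: u).
pose DS k (x : R * R) := 'd (Z x.1) (z + x.2 *: u) u ord0 k.
have cline (x : R * R) : {for x, continuous (fun x : R * R => (x.1, z + x.2 *: u))}.
  have c1 : {for x, continuous (fun x : R * R => x.1)} by exact: cvg_fst.
  have c2 : {for x, continuous (fun x : R * R => z + x.2 *: u)}.
    apply: cvgD; first exact: cvg_cst.
    by apply: cvgZr_tmp; exact: cvg_snd.
  exact: (cvg_pair c1 c2).
have nab : \forall x \near (t0, s0), a < x.1 < b.
  have /nbhs_ballP[r /= r0 hr] := near_itv tab.
  by apply/nbhs_ballP; exists r => //= -[t s] [/= h _]; exact: hr.
have cDS k : {for (t0, s0), continuous (DS k)}.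
  apply: (@continuous_diff_Jac _ _ _ _ (fun x : R * R => Z x.1) (fun x => z + x.2 *: u)).
  have [_ cJ _] := hZ _ (z + s0 *: u) tab.
  exact: (@continuous_comp _ _ _ (fun x : R * R => (x.1,
    z + x.2 *: u)) (fun tz => Jac (Z tz.1) tz.2)).
have dsS k (x : R * R) : a < x.1 < b -> is_derive (x.2 : R) 1 (fun s => S (x.1,
  s) ord0 k) (DS k x).
  move=> xab; have [dZ _ _] := hZ _ (z + x.2 *: u) xab.
  by rewrite /DS -(diff_coord _ _ dZ); apply: is_derive_line;
    exact: differentiable_coord_comp.
have dtS k (x : R * R) : a < x.1 < b ->
    is_derive (x.1 : R) 1 (fun t => S (t,
      x.2) ord0 k) (friction_field U K c (S x) ord0 k).
  by move=> xab; have [_ _] := hZ _ (z + x.2 *: u) xab; apply.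
have PS k : [/\ differentiable (fun x => S x ord0 k) (t0, s0),
    'd (fun x => S x ord0 k) (t0, s0) (1, 0) = friction_field U K c (S (t0, s0)) ord0 k
    & 'd (fun x => S x ord0 k) (t0, s0) (0, 1) = DS k (t0, s0)].
  apply: differentiable_partial => //; first exact: (dtS k (t0, s0)).
  by apply: filterS nab => x; exact: dsS.
have dS : differentiable S (t0, s0) by apply: differentiable_rV => k; case: (PS k).
have dQ : differentiable (fun x => qpart (S x)) (t0, s0).
  by apply: (differentiable_comp dS); exact: differentiable_lsubmx.
have dP : differentiable (fun x => ppart (S x)) (t0, s0).
  by apply: (differentiable_comp dS); exact: differentiable_rsubmx.
have dfst : differentiable (fun x : R * R => x.1) (t0, s0).
  by case: (is_diff_fst (t0, s0)).
have dexp : differentiable (fun x : R * R => expR (- c * x.1)) (t0, s0).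
  apply: (@differentiable_comp _ _ _ _ (fun x : R * R => x.1) (fun t : R =>
    expR (- c * t))) => //.
  by apply/derivable1_diffP; case: (is_derive_expRM c t0).
have cexp : {for (t0, s0), continuous (fun x : R * R => expR (- c * x.1))}.
  exact: differentiable_continuous.
pose H (x : R * R) := expR (- c * x.1) * (U (qpart (S x)) + K (ppart (S x))).
have dUQ : differentiable (fun x => U (qpart (S x))) (t0, s0).
  exact: (@differentiable_comp _ _ _ _ (fun x => qpart (S x)) U).
have dKP : differentiable (fun x => K (ppart (S x))) (t0, s0).
  exact: (@differentiable_comp _ _ _ _ (fun x => ppart (S x)) K).
have dUK := differentiableD dUQ dKP.
have dH : differentiable H (t0, s0) by exact: (differentiableM dexp dUK).
have dQE (i : 'I_d) : 'd (fun x => qpart (S x)) (t0, s0) (0,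
  1) ord0 i = DS (lshift d i) (t0, s0).
  rewrite -(diff_coord _ _ dQ); have [_ _ <-] := PS (lshift d i).
  rewrite (_ : (fun x => qpart (S x) ord0 i) = (fun x => S x ord0 (lshift d i)))//.
  by apply/funext => x; rewrite mxE.
have dPE (i : 'I_d) : 'd (fun x => ppart (S x)) (t0, s0) (0,
  1) ord0 i = DS (rshift d i) (t0, s0).
  rewrite -(diff_coord _ _ dP); have [_ _ <-] := PS (rshift d i).
  rewrite (_ : (fun x => ppart (S x) ord0 i) = (fun x => S x ord0 (rshift d i)))//.
  by apply/funext => x; rewrite mxE.
have dexp0 : 'd (fun x : R * R => expR (- c * x.1)) (t0, s0) (0, 1) = 0.
  have de : differentiable (fun t : R => expR (- c * t)) t0.
    by apply/derivable1_diffP; case: (is_derive_expRM c t0).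
  rewrite (diff_comp_at (f := fst) (g := fun t : R => expR (- c * t)))//.
  by have [_ ->] := is_diff_fst (t0, s0); rewrite /= linear0.
have HE : 'd H (t0, s0) (0, 1) = expR (- c * t0) *
    (\sum_(i < d) DS (lshift d i) (t0, s0) * grad U (qpart (S (t0, s0))) ord0 i
     + \sum_(i < d) DS (rshift d i) (t0, s0) * grad K (ppart (S (t0, s0))) ord0 i).
  have EU : 'd (fun x => U (qpart (S x))) (t0, s0) (0, 1)
      = \sum_(i < d) DS (lshift d i) (t0, s0) * grad U (qpart (S (t0, s0))) ord0 i.
    apply: (etrans (diff_comp_at (f := fun x => qpart (S x)) (g := U) _ dQ (hU _))).
    apply: (etrans (diff_grad _ (hU _))).
    by apply: eq_bigr => i _; congr (_ * _); exact: dQE.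
  have EK : 'd (fun x => K (ppart (S x))) (t0, s0) (0, 1)
      = \sum_(i < d) DS (rshift d i) (t0, s0) * grad K (ppart (S (t0, s0))) ord0 i.
    apply: (etrans (diff_comp_at (f := fun x => ppart (S x)) (g := K) _ dP (hK _))).
    apply: (etrans (diff_grad _ (hK _))).
    by apply: eq_bigr => i _; congr (_ * _); exact: dPE.
  apply: (etrans (diffM_at _ dexp dUK)).
  apply: (etrans (congr2 (fun x y => _ * x + _ * y) (diffD_at _ dUQ dKP) dexp0)).
  by rewrite mulr0 addr0; congr (_ * (_ + _)).
have C1 (i : 'I_d) := @curl_at_mul R (fun x => S x ord0 (lshift d i))
  (fun x => expR (- c * x.1) * S x ord0 (rshift d i))
  (fun x => - (expR (- c * x.1) * grad U (qpart (S x)) ord0 i))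
  (fun x => expR (- c * x.1) * DS (rshift d i) x) t0 s0.
have {}C1 (i : 'I_d) := C1 i (let: And3 h _ _ := PS (lshift d i) in h).
have c1 (i : 'I_d) : {for (t0, s0),
  continuous (fun x => - (expR (- c * x.1) * grad U (qpart (S x)) ord0 i))}.
  apply: continuousN; apply: continuousM => //.
  apply: (@continuous_comp _ _ _ (fun x =>
    grad U (qpart (S x))) (fun M : 'rV[R]_d => M ord0 i)); last exact: coord_continuous.
  by apply: (@continuous_comp _ _ _ (fun x => qpart (S x)) (grad U));
    [exact: differentiable_continuous|exact: cU].
have c2 (i : 'I_d) : {for (t0, s0),
  continuous (fun x => expR (- c * x.1) * DS (rshift d i) x)}.
  by apply: continuousM => //; exact: cDS.
have c3 (i : 'I_d) : \forall x \near (t0, s0),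
    is_derive (x.1 : R) 1 (fun t => expR (- c * t) * S (t, x.2) ord0 (rshift d i))
      (- (expR (- c * x.1) * grad U (qpart (S x)) ord0 i)) /\
    is_derive (x.2 : R) 1 (fun s => expR (- c * x.1) * S (x.1, s) ord0 (rshift d i))
      (expR (- c * x.1) * DS (rshift d i) x).
  apply: filterS nab => x xab; split.
    apply: (is_derive_eq (is_deriveM (is_derive_expRM c x.1) (dtS (rshift d i) x xab))).
    rewrite /friction_field row_mxEr !mxE /GRing.scale /= -surjective_pairing; ring.
  exact: (@is_deriveZ _ _ _ (fun s => S (x.1,
    s) ord0 (rshift d i)) (expR (- c * x.1)) x.2 1 _ (dsS (rshift d i) x xab)).
have {}C1 (i : 'I_d) := C1 i (c1 i) (c2 i) (c3 i).
have ccst (r : R) : {for (t0, s0), continuous (fun _ : R * R => r)}.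
  exact: cst_continuous.
have did : \forall x \near (t0, s0), is_derive (x.1 : R) 1 (fun t : R => t) 1 /\
    is_derive (x.2 : R) 1 (fun _ : R => x.1 : R) 0.
  by apply: filterE => x; split; [exact: is_derive_id|exact: is_derive_cst].
have C2 := @curl_at_mul R H (fun x => x.1) (fun=> 1) (fun=> 0) t0 s0 dH
  (ccst 1) (ccst 0) did.
have EC2 : 'd H (t0, s0) (1, 0) * 0 - 'd H (t0, s0) (0, 1) * 1 = - _ :=
  etrans (congr2 (fun x y => x - y) (mulr0 _) (mulr1 _))
    (etrans (sub0r _) (congr1 -%R HE)).
have := curl_atD (curl_at_sum C1) (eq_ind _ (fun k => curl_at _ _ k t0 s0) C2 _ EC2).
rewrite /=.
have -> : (fun t s : R => \sum_i S (t,
  s) ord0 (lshift d i) * (expR (- c * t) * DS (rshift d i) (t, s))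
    + H (t, s) * 0) = fun t s => scaled_pullback c Z u t (z + s *: u).
  by apply/funext => t; apply/funext => s; rewrite mulr0 addr0.
have -> : (fun t s : R => \sum_i S (t,
  s) ord0 (lshift d i) * - (expR (- c * t) * grad U (qpart (S (t, s))) ord0 i)
    + H (t, s) * 1) = fun t s => action_density U K c Z t (z + s *: u).
  by apply/funext => t; apply/funext => s; rewrite mulr1.
congr curl_at; rewrite -big_split /= mulr_sumr -sumrB big1// => i _.
have [_ -> ->] := PS (lshift d i); rewrite /friction_field row_mxEl; ring.
Qed.

Lemma continuous_qpart (R : realType) (d : nat) : continuous (@qpart R d).
Proof. exact: continuous_lsubmx. Qed.

Lemma continuous_ppart (R : realType) (d : nat) : continuous (@ppart R d).
Proof. exact: continuous_rsubmx. Qed.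

Lemma omega_conformal (R : realType) (d : nat) (U K : 'rV[R]_d -> R) (c a b : R)
    (Z : R -> 'rV[R]_(d + d) -> 'rV[R]_(d + d))
    (hU : forall q, differentiable U q) (cU : continuous (grad U))
    (hK : forall p, differentiable K p) (hZ : C1_solution (friction_field U K c) a b Z)
    (t1 t2 : R) (z u v : 'rV[R]_(d + d)) : a < t1 -> t1 <= t2 -> t2 < b ->
  expR (- c * t1) * omega Z t1 z u v = expR (- c * t2) * omega Z t2 z u v.
Proof.
move=> at1 t12 t2b.
pose w := action_density U K c Z.
have tab t : t1 <= t <= t2 -> a < t < b by move=> h; lra.
have cZ t y : a < t < b -> {for t, continuous (fun s => Z s y)}.
  move=> h; apply: differentiable_continuous; apply: differentiable_rV => k.
  by apply/derivable1_diffP; have [_ _ /(_ k)] := hZ t y h; case.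
have cw t y : a < t < b -> {for t, continuous (fun t => w t y)}.
  move=> h; have cZt := cZ t y h.
  have cq : {for t, continuous (fun s => qpart (Z s y))}.
    exact: (@continuous_comp _ _ _ (fun s =>
      Z s y) (@qpart R d) t cZt (@continuous_qpart R d _)).
  have cp : {for t, continuous (fun s => ppart (Z s y))}.
    exact: (@continuous_comp _ _ _ (fun s =>
      Z s y) (@ppart R d) t cZt (@continuous_ppart R d _)).
  have ce : {for t, continuous (fun s : R => expR (- c * s))}.
    by apply: differentiable_continuous; apply/derivable1_diffP;
      case: (is_derive_expRM c t).
  apply: (@continuousD _ _ _ (fun t => _) (fun t => _)).
    apply: continuous_sum_at => i; apply: (@continuousM _ _ (fun t => _) (fun t => _)).
      exact: (@continuous_comp _ _ _ (fun s => Z s y) (fun M : 'rV[R]_(d + d) =>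
        M ord0 _) t cZt (@coord_continuous _ _ _ _ _ _)).
    apply: (@continuousN _ _ _ (fun t => _)).
    apply: (@continuousM _ _ (fun t => _) (fun t => _)); first exact: ce.
    apply: (@continuous_comp _ _ _ (fun s =>
      grad U (qpart (Z s y))) (fun M : 'rV[R]_d => M ord0 i));
        last exact: coord_continuous.
    exact: (@continuous_comp _ _ _ (fun s => qpart (Z s y)) (grad U) t cq (cU _)).
  apply: (@continuousM _ _ (fun t => _) (fun t => _)); first exact: ce.
  apply: (@continuousD _ _ _ (fun t => _) (fun t => _)).
    exact: (@continuous_comp _ _ _ (fun s =>
      qpart (Z s y)) U t cq (differentiable_continuous (hU _))).
  exact: (@continuous_comp _ _ _ (fun s =>
    ppart (Z s y)) K t cp (differentiable_continuous (hK _))).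
pose a' := (a + t1) / 2; pose b' := (t2 + b) / 2.
have /choice[B HB] : forall y, exists B : R -> R,
    forall t, a' < t < b' -> is_derive t 1 B (w t y).
  by move=> y; apply: exists_primitive => t h; apply: cw; move: h; rewrite /a' /b'; lra.
pose V y := B y t2 - B y t1.
have cD t y x k : a < t < b -> {for y, continuous (fun y => 'd (Z t) y x ord0 k)}.
  move=> h; apply: (@continuous_diff_Jac _ _ _ _ (fun=> Z t) id).
  have [_ cJ _] := hZ t y h.
  have cpair : {for y, continuous (fun y : 'rV[R]_(d + d) => (t, y))}.
    have c1 : {for y, continuous (fun _ : 'rV[R]_(d + d) => t)} by exact: cst_continuous.
    have c2 : {for y, continuous (fun y : 'rV[R]_(d + d) => y)} by exact: cvg_id.
    exact: (cvg_pair c1 c2).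
  exact: (continuous_comp cpair cJ).
have dV (y x : 'rV[R]_(d + d)) (s : R) : is_derive s 1 (fun s => V (y + s *: x))
    (scaled_pullback c Z x t2 (y + s *: x) - scaled_pullback c Z x t1 (y + s *: x)).
  apply: (@derive_primitive R (fun t s => scaled_pullback c Z x t (y + s *: x))
    (fun t s => w t (y + s *: x)) (fun t s => B (y + s *: x) t) t1 t2 s 1) =>
      // t s' ht _.
  have htab := tab t ht; split; last exact (@flow_curl R d U K c a b Z hU cU hK hZ
    y x t s' htab).
  - have cl : {for s', continuous (fun s : R => y + s *: x)}.
      apply: cvgD; first exact: cvg_cst.
      by apply: cvgZr_tmp; exact: cvg_id.
    apply: (@continuous_comp _ _ _ (fun s : R =>
      y + s *: x) (scaled_pullback c Z x t) s' cl).
    apply: continuous_sum_at => i; apply: (@continuousM _ _ (fun t => _) (fun t => _)).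
      apply: (@continuous_comp _ _ _ (Z t) (fun M : 'rV[R]_(d + d) =>
        M ord0 (lshift d i))); last exact: coord_continuous.
      by apply: differentiable_continuous; case: (hZ t (y + s' *: x) htab).
    apply: (@continuousM _ _ (fun t => _) (fun t => _)); first exact: cst_continuous.
    exact: cD.
  - by apply: HB; rewrite /a' /b'; move: ht at1 t2b; lra.
have hk t (e : R) (ht : a < t < b) : curl_at
    (fun s r => \sum_(i < d) (e * Z t (z + s *: u + r *: v) ord0 (lshift d i))
       * 'd (fun y => Z t y ord0 (rshift d i)) (z + s *: u + r *: v) v)
    (fun s r => \sum_(i < d) (e * Z t (z + s *: u + r *: v) ord0 (lshift d i))
       * 'd (fun y => Z t y ord0 (rshift d i)) (z + s *: u + r *: v) u)
    (e * omega Z t z u v) 0 0.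
  have dZ y : differentiable (Z t) y by case: (hZ t y ht).
  have dl i y : differentiable (fun y => e * Z t y ord0 (lshift d i)) y.
    by apply: (@differentiableZ _ _ _ (fun y => Z t y ord0 (lshift d i)));
      exact: differentiable_coord_comp.
  have dr i y : differentiable (fun y =>
    Z t y ord0 (rshift d i)) y by exact: differentiable_coord_comp.
  have cr i x : {for z, continuous (fun y => 'd (fun y => Z t y ord0 (rshift d i)) y x)}.
    rewrite (_ : (fun y => _) = (fun y => 'd (Z t) y x ord0 (rshift d i)));
      first exact: cD.
    by apply/funext => y; exact: diff_coord.
  have Cs := curl_at_sum (fun i : 'I_d =>
    curl_at_pullback (dl i z) (dr i) (cr i u) (cr i v)).
  apply: (eq_ind _ (fun k => curl_at _ _ k 0 0) Cs).
  rewrite omegaE// mulr_sumr; apply: eq_bigr => i _.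
  have dE x : 'd (fun y => e * Z t y ord0 (lshift d i)) z x = e * 'd (Z t) z x ord0
    (lshift d i).
    apply: (etrans (diffM_at _ (differentiable_cst e z) (differentiable_coord_comp
      _ (dZ z)))).
    rewrite (@diff_cst R _ _ e z) mulr0 addr0; congr (_ * _); exact: diff_coord.
  have rE x : 'd (fun y => Z t y ord0 (rshift d i)) z x = 'd (Z t) z x ord0 (rshift d i).
    exact: diff_coord.
  apply: (etrans (congr2 (fun p q =>
    p - q) (congr2 *%R (dE u) (rE v)) (congr2 *%R (dE v) (rE u)))).
  by rewrite mulrBr !mulrA.
have C := curl_atD (hk t2 (expR (- c * t2)) ltac:(lra)) (hk t1 (- expR (- c * t1))
  ltac:(lra)).
have spE t x y : a < t < b -> scaled_pullback c Z x t y =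
    \sum_(i < d) (expR (- c * t) * Z t y ord0 (lshift d i)) * 'd (fun y =>
      Z t y ord0 (rshift d i)) y x.
  move=> h; apply: eq_bigr => i _; have [dZ _ _] := hZ t y h.
  rewrite mulrCA mulrA; congr (_ * _); exact/esym/diff_coord.
have spN t x y : a < t < b -> - scaled_pullback c Z x t y =
    \sum_(i < d) (- expR (- c * t) * Z t y ord0 (lshift d i)) * 'd (fun y =>
      Z t y ord0 (rshift d i)) y x.
  by move=> h; rewrite spE// -sumrN; apply: eq_bigr => i _; rewrite !mulNr.
have := curl_exact C (V := fun s r => V (z + s *: u + r *: v)).
suff HV : exists2 r : R, 0 < r & forall s q : R, `|s - 0| < r -> `|q - 0| < r ->
   is_derive q 1 (fun q => V (z + s *: u + q *: v)) (scaled_pullback c Z v t2 (z +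
     s *: u + q *: v) - scaled_pullback c Z v t1 (z + s *: u + q *: v)) /\
   is_derive s 1 (fun s => V (z + s *: u + q *: v)) (scaled_pullback c Z u t2 (z +
     s *: u + q *: v) - scaled_pullback c Z u t1 (z + s *: u + q *: v)).
  have [r r0 {}HV] := HV; move=> H; apply/eqP; rewrite eq_sym -subr_eq0 -mulNr;
    apply/eqP; apply: H.
  exists r => // s q hs hq; have [h1 h2] := HV s q hs hq.
  by split; [apply: (is_derive_eq h1)|apply: (is_derive_eq h2)]; rewrite spE ?spN//; lra.
exists 1 => // s q _ _; split; first exact: dV.
have := dV (z + q *: v) u s; rewrite addrAC => D.
by rewrite (_ : (fun s => _) = (fun s => V (z + q *: v + s *: u)))//;
  apply/funext => x; rewrite addrAC.
Qed.

Lemma is_derive_within (R : realType) (n : nat) (A : set R) (x : R -> 'rV[R]_n) (t : R)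
    (v : 'rV[R]_n) (k : 'I_n) : derive_within A x t v -> (\forall s \near t, A s) ->
  is_derive t 1 (fun s => x s ord0 k) (v ord0 k).
Proof.
move=> xv nA.
have gv : (s - t)^-1 * (x s ord0 k - x t ord0 k) @[s --> within A t^'] --> v ord0 k.
  have := cvg_comp _ _ xv (@coord_continuous _ _ _ ord0 k v).
  by apply: cvg_trans; apply: near_eq_cvg; near=> s; rewrite /= !mxE.
have dv : h^-1 *: (x (h *: 1 + t) ord0 k - x t ord0 k) @[h --> 0^'] --> v ord0 k.
  apply/cvgrPdist_le => e e0; move/cvgrPdist_le: gv => /(_ e e0).
  rewrite !near_withinE => gv.
  have {}gv : \forall s \near t, s != t ->
    `|v ord0 k - (s - t)^-1 * (x s ord0 k - x t ord0 k)| <= e.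
    by apply: filterS2 nA gv => s As h st; apply: h.
  have : \forall h \near (0 : R), h != 0 ->
    `|v ord0 k - h^-1 *: (x (h *: 1 + t) ord0 k - x t ord0 k)| <= e; last by [].
  move: gv; rewrite (near_shift 0 t); apply: filterS => h /=.
  rewrite subr0 => H h0; rewrite [h *: 1]mulr1; move: H; rewrite addrK; apply.
  by rewrite -subr_eq0 addrK.
apply: DeriveDef; first by apply/cvg_ex; exists (v ord0 k).
exact: cvg_lim dv.
Unshelve. all: by end_near. Qed.

Lemma within_continuous_at (T U : topologicalType) (A : set T) (f : T -> U) (x : T) :
  {within A, continuous f} -> (\forall y \near x, A y) -> {for x, continuous f}.
Proof.
move=> /subspace_continuousP cf nA; have Ax := nbhs_singleton nA.
move=> B /(cf x Ax); rewrite /fmap /= /nbhs /= /within /= => H.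
by apply: filterS2 nA H => y Ay; apply.
Qed.

Lemma constant_closure (R : realType) (f : R -> R) (a b : R) : a < b ->
  {within `[a, b], continuous f} ->
  (forall s t, a < s -> s <= t -> t < b -> f s = f t) ->
  forall t, a <= t <= b -> f t = f ((a + b) / 2).
Proof.
move=> ab /subspace_continuousP cf fC t tab; set m := (a + b) / 2.
have am : a < m < b by rewrite /m; lra.
apply/eqP; rewrite -subr_eq0 -normr_le0; apply/ler_addgt0Pr => e e0; rewrite add0r.
have /cf : `[a, b]%classic t by rewrite /= in_itv.
move=> /cvgrPdist_le/(_ e e0); rewrite near_withinE => /nbhs_ballP[r /= r0 H].
pose th := Num.min (1 / 2) (r / (2 * (b - a))).
have ba : 0 < b - a by rewrite subr_gt0.
have th0 : 0 < th by rewrite lt_min !divr_gt0// mulr_gt0.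
have th1 : th <= 1 / 2 by rewrite ge_min lexx.
have thr : th * (b - a) < r.
  apply: (@le_lt_trans _ _ (r / 2)); last by lra.
  have : th <= r / (2 * (b - a)) by rewrite ge_min lexx orbT.
  by rewrite invfM mulrA ler_pdivlMr.
pose s := t + th * (m - t).
have sab : a < s < b.
  rewrite /s; apply/andP; split.
    have -> : t + th * (m - t) = a + ((1 - th) * (t - a) + th * (m - a)) by ring.
    rewrite ltrDl ltr_wpDl// ?mulr_ge0 ?mulr_gt0//; lra.
  have -> : t + th * (m - t) = b - ((1 - th) * (b - t) + th * (b - m)) by ring.
  rewrite gtrBl ltr_wpDl// ?mulr_ge0 ?mulr_gt0//; lra.
have -> : f m = f s.
  have [sm|/ltW ms] := leP s m; [apply/esym|]; apply: fC => //; lra.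
apply: H; last by rewrite /= in_itv /=; lra.
rewrite /ball /= /s opprD addrA subrr sub0r normrN normrM (gtr0_norm th0).
apply: le_lt_trans thr; rewrite ler_pM2l// ler_norml; lra.
Qed.

Lemma mulmx_Omega (R : realType) (d : nat) :
  Omega R d *m block_mx 0 (- 1%:M) 1%:M 0 = 1%:M.
Proof.
rewrite /Omega mulmx_block !mul0mx !mulmx0 !mulmx1 mulNmx mulmxN mulmx1 opprK.
by rewrite !addr0 !add0r [RHS]scalar_mx_block.
Qed.

Lemma invmx_Omega (R : realType) (d : nat) :
  invmx (Omega R d) = block_mx 0 (- 1%:M) 1%:M 0.
Proof.
have [uO _] := mulmx1_unit (mulmx_Omega R d).
by rewrite -[RHS](mulKmx uO) mulmx_Omega mulmx1.
Qed.

Lemma invmx_Omega_form (R : realType) (d : nat) (x y : 'rV[R]_(d + d)) :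
  (x *m invmx (Omega R d) *m y^T) ord0 ord0 = - \sum_(i < d)
    (x ord0 (lshift d i) * y ord0 (rshift d i) - y ord0 (lshift d i) * x ord0
      (rshift d i)).
Proof.
rewrite invmx_Omega -{1}[x]hsubmxK -{1}[y]hsubmxK tr_row_mx mul_row_block mul_row_col.
rewrite !mulmx0 mulmx1 mulmxN mulmx1 add0r addr0 mulNmx !mxE -sumrB -sumrN.
by apply: eq_bigr => i _; rewrite !mxE; ring.
Qed.

Lemma row_entry (R : realType) (m n : nat) (A : 'M[R]_(m, n)) (i : 'I_m) (j : 'I_n) :
  (delta_mx ord0 i *m A *m (delta_mx ord0 j)^T) (ord0 : 'I_1) (ord0 : 'I_1) = A i j.
Proof. by rewrite -rowE trmx_delta -colE !mxE. Qed.

Lemma C1_solution_within (R : realType) (d : nat) (U K : 'rV[R]_d -> R) (c a b T : R)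
    (A : set R) (Z : R -> 'rV[R]_(d + d) -> 'rV[R]_(d + d)) :
  0 <= a -> b <= T -> C1_in_initial_state T Z ->
  (forall t, a < t < b -> A t) ->
  (forall z t, a < t < b ->
    derive_within A (fun s => qpart (Z s z)) t (grad K (ppart (Z t z))) /\
    derive_within A (fun s => ppart (Z s z)) t
      (- grad U (qpart (Z t z)) + c *: ppart (Z t z))) ->
  C1_solution (friction_field U K c) a b Z.
Proof.
move=> a0 bT [dZ cJ] Aab hder t z tab.
have nA : \forall s \near t, A s by apply: filterS (near_itv tab) => s; exact: Aab.
have [hq hp] := hder z t tab.
split.
- by apply: dZ; lra.
- apply: (within_continuous_at cJ).
  have /nbhs_ballP[r /= r0 H] := near_itv tab.
  apply/nbhs_ballP; exists r => //= -[s y] [/= hs _]; split => //=.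
  by have := H s hs; rewrite in_itv /=; lra.
- move=> k; rewrite /friction_field; case: (split_ordP k) => i ->.
  + rewrite row_mxEl (_ : (fun s => _) = (fun s => qpart (Z s z) ord0 i)).
      exact: is_derive_within hq nA.
    by apply/funext => s; rewrite mxE.
  + rewrite row_mxEr (_ : (fun s => _) = (fun s => ppart (Z s z) ord0 i)).
      exact: is_derive_within hp nA.
    by apply/funext => s; rewrite mxE.
Qed.

Lemma continuous_omega (R : realType) (d : nat) (c T : R)
    (Z : R -> 'rV[R]_(d + d) -> 'rV[R]_(d + d)) (z u v : 'rV[R]_(d + d)) :
  C1_in_initial_state T Z ->
  {within `[0, T], continuous (fun t : R => expR (- c * t) * omega Z t z u v)}.
Proof.
move=> [dZ cJ]; have : {within `[0, T],
  continuous (fun t : R => expR (- c * t) * (\sum_(i < d)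
    ('d (Z t) z u ord0 (lshift d i) * 'd (Z t) z v ord0 (rshift d i)
     - 'd (Z t) z v ord0 (lshift d i) * 'd (Z t) z u ord0 (rshift d i))))}.
  have cZ : {within `[0, T], continuous (fun t => Jac (Z t) z)}.
    apply/subspace_continuousP => t tT.
    have := (iffLR (subspace_continuousP _ _) cJ (t, z)) (conj tT I).
    move=> H B /H; rewrite /fmap /= /within /= => /nbhs_ballP[r /= r0 HB].
    apply/nbhs_ballP; exists r => //= s hs sT.
    by apply: (HB (s, z)) => //; split => //; exact: ballxx.
  have cD x k : {within `[0, T], continuous (fun t => 'd (Z t) z x ord0 k)}.
    move=> t; exact: (@continuous_diff_Jac R _ _ (subspace `[0,
      T]) Z (fun=> z) t x k (cZ t)).
  move=> t; apply: (@continuousM R (subspace `[0, T]) (fun t => _) (fun t => _)).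
    apply: continuous_subspaceT => s; apply: differentiable_continuous.
    by apply/derivable1_diffP; case: (is_derive_expRM c s).
  apply: continuous_sum_at => i.
  apply: (@continuousB R _ (subspace `[0, T]) (fun t => _) (fun t => _));
    apply: (@continuousM R (subspace `[0, T]) (fun t => _) (fun t => _)); exact: cD.
apply: subspace_eq_continuous => t /[!inE] /=; rewrite in_itv /= => tT.
by congr (_ * _); apply/esym/omegaE; exact: dZ.
Qed.

Lemma ra_omegaE (R : realType) (d : nat) (U K : 'rV[R]_d -> R) (gamma T : R)
    (Z : R -> 'rV[R]_(d + d) -> 'rV[R]_(d + d)) :
  C1 U -> (forall p, differentiable K p) -> 0 < T ->
  ra_flow U K gamma T Z -> C1_in_initial_state T Z ->
  forall t z u v, 0 <= t <= T ->
    omega Z t z u v = expR (gamma * (if t <= T / 2 then t else T - t)) * omega Z 0 z u v.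
Proof.
move=> [dU cU] dK T0 hZ hZ1 t z u v tT.
have S1 : C1_solution (friction_field U K gamma) 0 (T / 2) Z.
  apply: (@C1_solution_within R d U K gamma 0 (T / 2) T `]0, T / 2]) => //; first by lra.
    by move=> s; rewrite /= in_itv /=; lra.
  by move=> y s sT; have [_ [_ H _]] := hZ y; apply: H; lra.
have S2 : C1_solution (friction_field U K (- gamma)) (T / 2) T Z.
  apply: (@C1_solution_within R d U K (- gamma) (T / 2) T T `]T / 2, T]) => //;
    first by lra.
    by move=> s; rewrite /= in_itv /=; lra.
  by move=> y s sT; have [_ [_ _ H]] := hZ y; rewrite scaleNr; apply: H; lra.
have cW (c a b : R) : 0 <= a -> b <= T ->
    {within `[a, b], continuous (fun t : R => expR (- c * t) * omega Z t z u v)}.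
  move=> a0 bT; have sub : `[a, b] `<=` `[0, T] by (move=> s; rewrite /= !in_itv /=; lra).
  exact: (continuous_subspaceW sub (@continuous_omega R d c T Z z u v hZ1)).
have C1' s := @constant_closure R _ 0 (T / 2) ltac:(lra) (cW gamma 0 (T / 2)
  ltac:(lra) ltac:(lra))
  (fun s t => omega_conformal dU cU dK S1 z u v (t1 := s) (t2 := t)) s.
have C2' s := @constant_closure R _ (T / 2) T ltac:(lra) (cW (- gamma) (T / 2) T
  ltac:(lra) ltac:(lra))
  (fun s t => omega_conformal dU cU dK S2 z u v (t1 := s) (t2 := t)) s.
have E1 s : 0 <= s <= T / 2 -> omega Z s z u v = expR (gamma * s) * omega Z 0 z u v.
  move=> hs; have := etrans (C1' s hs) (esym (C1' 0 ltac:(lra))).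
  rewrite mulr0 expR0 mul1r => <-.
  by rewrite mulrA -expRD mulNr addrN expR0 mul1r.
case: ifP => tT2; first by apply: E1; lra.
have /negbT := tT2; rewrite -ltNge => {}tT2.
have := etrans (C2' t ltac:(lra)) (esym (C2' (T / 2) ltac:(lra))).
rewrite (E1 (T / 2)) ?opprK; last lra.
rewrite mulrA -expRD => H.
apply: (mulfI (lt0r_neq0 (expR_gt0 (gamma * t)))); rewrite H [RHS]mulrA -expRD.
by congr (expR _ * _); field.
Qed.

Lemma omega_id (R : realType) (d : nat) (Z : R -> 'rV[R]_(d + d) ->
  'rV[R]_(d + d)) (t : R)
    (z u v : 'rV[R]_(d + d)) : Z t = id ->
  omega Z t z u v = \sum_(i < d)
    (u ord0 (lshift d i) * v ord0 (rshift d i) - v ord0 (lshift d i) * u ord0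
      (rshift d i)).
Proof.
move=> Zt; have dZ : is_diff z (Z t) id by rewrite Zt; exact: is_diff_id.
by rewrite omegaE// diff_val.
Qed.

Lemma omega_id_eq1 (R : realType) (d : nat) (Z : R -> 'rV[R]_(d + d) -> 'rV[R]_(d + d))
    (t : R) (z : 'rV[R]_(d + d)) : (0 < d)%N -> Z t = id -> exists u v,
      omega Z t z u v = 1.
Proof.
move=> d0 Zt; pose i0 := Ordinal d0.
exists (delta_mx ord0 (lshift d i0)), (delta_mx ord0 (rshift d i0)).
apply: (etrans (omega_id _ _ _ Zt)); clear Zt.
rewrite (bigD1 i0)//= big1 ?addr0 => [|i ii0].
  by rewrite !mxE !eqxx /= eq_lrshift eq_rlshift !(mulr0, mul0r) subr0 mulr1.
rewrite !mxE !(eq_lshift, eq_rshift, eq_lrshift, eq_rlshift) (negbTE ii0) /=.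
by rewrite !(mulr0, mul0r) subr0.
Qed.

Lemma mulmx_form_inj (R : realType) (n : nat) (A B : 'M[R]_n) :
  (forall u v : 'rV[R]_n, (u *m A *m v^T) ord0 ord0 = (u *m B *m v^T) ord0 ord0) -> A = B.
Proof. by move=> H; apply/matrixP => i j; rewrite -row_entry H row_entry. Qed.

Lemma symplectic_Jac (R : realType) (d : nat) (F : 'rV[R]_(d + d) -> 'rV[R]_(d + d))
    (z : 'rV[R]_(d + d)) : differentiable F z ->
  omega (fun=> F) 0 z = omega (fun=> id) 0 z ->
  (Jac F z)^T *m invmx (Omega R d) *m Jac F z = invmx (Omega R d).
Proof.
move=> dF E; apply: mulmx_form_inj => u v.
have {}E := etrans (esym (@omegaE R d (fun=> F) 0 z u v dF))
  (etrans (congr1 (fun f => f u v) E) (@omega_id R d (fun=> id) 0 z u v erefl)).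
rewrite invmx_Omega_form -E.
have -> : u *m ((Jac F z)^T *m invmx (Omega R d) *m Jac F z) *m v^T
    = 'd F z u *m invmx (Omega R d) *m ('d F z v)^T.
  by rewrite -!mulmx_Jac trmx_mul trmxK !mulmxA.
by rewrite invmx_Omega_form.
Qed.

Lemma symplectic_det (R : realType) (d : nat) (M : 'M[R]_(d + d)) :
  M^T *m invmx (Omega R d) *m M = invmx (Omega R d) -> `|\det M| = 1.
Proof.
move=> /(congr1 determinant); rewrite !det_mulmx det_tr.
have uO : \det (invmx (Omega R d)) != 0.
  by rewrite -unitfE -unitmxE unitmx_inv; have [] := mulmx1_unit (mulmx_Omega R d).
rewrite mulrAC -{2}[\det (invmx _)]mul1r => /(mulIf uO) H.
by apply/eqP; rewrite -sqr_norm_eq1 expr2; apply/eqP.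
Qed.

Lemma exact_flow_symplectic (R : realType) (d : nat) (U K : 'rV[R]_d -> R) (gamma T : R)
    (Z : R -> 'rV[R]_(d + d) -> 'rV[R]_(d + d)) : (0 < d)%N ->
  C1 U -> (forall p, differentiable K p) -> 0 < gamma -> 0 < T ->
  ra_flow U K gamma T Z -> C1_in_initial_state T Z ->
  [/\ omega Z T = omega Z 0,
      forall t, 0 < t < T -> omega Z t <> omega Z 0
    & forall z, (Jac (Z T) z)^T *m invmx (Omega R d) *m Jac (Z T) z = invmx (Omega R d)].
Proof.
move=> d0 hU hK g0 T0 hZ hZ1.
have Z0 : Z 0 = id by apply/funext => z; have [] := hZ z.
have E := ra_omegaE hU hK T0 hZ hZ1.
have ET : omega Z T = omega Z 0.
  apply/funext => z; apply/funext => u; apply/funext => v; rewrite E; last lra.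
  by rewrite ifF ?subrr ?mulr0 ?expR0 ?mul1r//; apply/negbTE; rewrite -ltNge; lra.
split; first exact: ET.
- move=> t tT; have lt1 : 1 < expR (gamma * (if t <= T / 2 then t else T - t)).
    by clear -g0 tT; rewrite expR_gt1 mulr_gt0//; case: ifP => _; lra.
  have [u [v uv]] := omega_id_eq1 0 d0 Z0.
  have {}E := E t 0 u v ltac:(lra).
  move=> H; move: E; rewrite H uv mulr1 => E1.
  by clear -E1 lt1; rewrite -E1 ltxx in lt1.
- move=> z; apply: symplectic_Jac; first by case: hZ1 => + _; apply; lra.
  have -> : omega (fun=> Z T) 0 z = omega Z T z by [].
  rewrite ET; apply/funext => u; apply/funext => v.
  by rewrite (omega_id _ _ _ Z0) (@omega_id R d (fun=> id) 0 z u v erefl).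
Qed.

(** * Limits of injective lattice maps *)

Lemma rV_coord_le (R : realType) (n : nat) (x : 'rV[R]_n) (i : 'I_n) : `|x ord0 i|
  <= `|x|.
Proof.
rewrite [leRHS]/Num.norm /= mx_normrE.
by apply: (le_trans _ (le_bigmax _ _ (ord0, i))) => /=.
Qed.

Lemma rV_norm_lt (R : realType) (n : nat) (x : 'rV[R]_n) (e : R) : 0 < e ->
  (forall i, `|x ord0 i| < e) -> `|x| < e.
Proof.
move=> e0 H; rewrite [ltLHS]/Num.norm /= mx_normrE.
by apply/bigmax_ltP; split => // -[i j] _ /=; rewrite [i]ord1.
Qed.

Lemma rV_norm_le (R : realType) (n : nat) (x : 'rV[R]_n) (e : R) : 0 <= e ->
  (forall i, `|x ord0 i| <= e) -> `|x| <= e.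
Proof.
move=> e0 H; rewrite [leLHS]/Num.norm /= mx_normrE.
by apply/bigmax_leP; split => // -[i j] _ /=; rewrite [i]ord1.
Qed.

Definition lattice_point (R : realType) (n N : nat) (k : 'rV[int]_n) : 'rV[R]_n :=
  \row_i ((k ord0 i)%:~R / N.+1%:R).

(* As [N] grows, injective maps of the lattice with mesh [1 / N.+1] converge
   to [F], uniformly near every point. *)
Definition lattice_limit (R : realType) (n : nat) (F : 'rV[R]_n -> 'rV[R]_n) :=
  exists2 s : nat -> 'rV[int]_n -> 'rV[int]_n, forall N, injective (s N) &
  forall (z : 'rV[R]_n) (e : R), 0 < e -> exists2 r : R, 0 < r &
    exists N0, forall N, (N0 <= N)%N -> forall k,
    `|lattice_point R N k - z| < r -> `|lattice_point R N (s N k) - F z| < e.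

Lemma lattice_limit_comp (R : realType) (n : nat) (F G : 'rV[R]_n -> 'rV[R]_n) :
  lattice_limit F -> lattice_limit G -> lattice_limit (G \o F).
Proof.
move=> [s si Hs] [t ti Ht]; exists (fun N => t N \o s N) => [N|z e e0].
  exact: inj_comp.
have [r r0 [N1 H1]] := Ht (F z) e e0; have [q q0 [N2 H2]] := Hs z r r0.
exists q => //; exists (maxn N1 N2) => N; rewrite geq_max => /andP[h1 h2] k hk.
by apply: H1 => //; exact: H2.
Qed.

Lemma lattice_limit_perm (R : realType) (n : nat) (p : {perm 'I_n}) :
  lattice_limit (fun x : 'rV[R]_n => col_perm p x).
Proof.
exists (fun _ => col_perm p) => [N k k' /rowP H|z e e0].
  apply/rowP => i; have := H ((p^-1)%g i).
  by rewrite !mxE permKV.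
exists e => //; exists 0%N => N _ k hk; apply: rV_norm_lt => // i.
have := rV_coord_le (lattice_point R N k - z) (p i).
by rewrite !mxE => /le_lt_trans; apply.
Qed.

Lemma lattice_limit_triangular (R : realType) (n : nat) (rk : 'I_n -> nat)
    (g : 'rV[R]_n -> 'rV[R]_n) : continuous g ->
  (forall (j : 'I_n) (x y : 'rV[R]_n), (forall i,
    (rk i < rk j)%N -> x ord0 i = y ord0 i) ->
    g x ord0 j = g y ord0 j) ->
  lattice_limit (fun x => x + g x).
Proof.
move=> cg dep.
exists (fun N k => k + \row_j Num.floor (N.+1%:R * g (lattice_point R N k) ord0 j)).
  move=> N k k' /rowP H; apply/rowP => j.
  have [m] := ubnP (rk j); elim: m j => // m IH j; rewrite ltnS => jm.
  have := H j; rewrite !mxE (dep j _ (lattice_point R N k')).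
    by move/addIr.
  by move=> i ij; rewrite !mxE IH// (leq_trans ij).
move=> z e e0.
have e20 : 0 < e / 2 by rewrite divr_gt0.
have cF : {for z, continuous (fun x : 'rV[R]_n => x + g x)}.
  exact: (@continuousD R _ _ (fun x : 'rV[R]_n => x) g z (@cvg_id _ _) (cg z)).
move/cvgrPdist_lt : cF => /(_ (e / 2) e20) /nbhs_ballP[r /= r0 Hr].
exists r => //; exists (Num.truncn (2 / e)) => N hN k hk.
have Ne : N.+1%:R^-1 < e / 2.
  rewrite -[e / 2]invrK ltf_pV2 ?posrE ?ltr0n ?invr_gt0// invf_div.
  apply: lt_le_trans (_ : (Num.truncn (2 / e)).+1%:R <= _); last by rewrite ler_nat ltnS.
  by have /truncn_itv/andP[] : 0 <= 2 / e by rewrite divr_ge0// ltW.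
set x := lattice_point R N k.
have hx : `|(z + g z) - (x + g x)| < e / 2.
  by apply: Hr; rewrite -ball_normE /= distrC.
have -> : e = e / 2 + e / 2 by field.
apply: rV_norm_lt; first by rewrite addr_gt0.
move=> i; have N0 : N.+1%:R != 0 :> R by rewrite pnatr_eq0.
rewrite !mxE intrD mulrDl.
set a := g x ord0 i.
have /andP[f1 f2] := floor_itv (N.+1%:R * a).
have h1 : `|(Num.floor (N.+1%:R * a))%:~R / N.+1%:R - a| <= N.+1%:R^-1.
  have -> : (Num.floor (N.+1%:R * a))%:~R / N.+1%:R - a =
     ((Num.floor (N.+1%:R * a))%:~R - N.+1%:R * a) / N.+1%:R by field.
  rewrite normrM [`|N.+1%:R^-1|]ger0_norm ?invr_ge0// ler_piMl ?invr_ge0//.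
  by move: f1 f2; rewrite intrD ler_norml; lra.
have := rV_coord_le (z + g z - (x + g x)) i; rewrite !mxE -/a => h2.
have -> : (k ord0 i)%:~R / N.+1%:R + (Num.floor (N.+1%:R * a))%:~R / N.+1%:R - (z
  ord0 i + g z ord0 i)
  = ((Num.floor (N.+1%:R * a))%:~R / N.+1%:R - a)
    - (z ord0 i + g z ord0 i - ((k ord0 i)%:~R / N.+1%:R + a)) by ring.
apply: le_lt_trans (ler_normB _ _) _.
by apply: ltrD; [exact: le_lt_trans h1 Ne|exact: le_lt_trans h2 hx].
Qed.

Lemma injective_box_card (n m : nat) (M : 'I_n -> nat) (s : 'rV[int]_n -> 'rV[int]_n) :
  injective s ->
  (forall k : 'rV[int]_n, (forall i, (`|k ord0 i| <= m)%N) -> forall i,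
    (`|s k ord0 i| <= M i)%N) ->
  (m.*2.+1 ^ n <= \prod_i (M i).*2.+1)%N.
Proof.
move=> si sM; pose B := (\sum_i M i)%N.
have MB i : (M i <= B)%N by rewrite /B (bigD1 i)//= leq_addr.
pose dec (phi : {ffun 'I_n -> 'I_m.*2.+1}) : 'rV[int]_n := \row_i ((phi i)%:Z - m%:Z).
pose f (phi : {ffun 'I_n -> 'I_m.*2.+1}) : {ffun 'I_n -> 'I_B.*2.+1} :=
  [ffun i => inord `|(s (dec phi) ord0 i + (M i)%:Z)%R|%N].
have decm phi i : (`|dec phi ord0 i| <= m)%N.
  by rewrite mxE; have := ltn_ord (phi i); lia.
have sM' phi i : (`|s (dec phi) ord0 i| <= M i)%N by apply: sM => j; exact: decm.
have fval phi i : nat_of_ord (f phi i) = `|(s (dec phi) ord0 i + (M i)%:Z)%R|%N.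
  by rewrite ffunE inordK//; have := sM' phi i; have := MB i; lia.
have fi : injective f.
  move=> phi psi H; have Hs : s (dec phi) = s (dec psi).
    apply/rowP => i; have := congr1 (fun h : {ffun 'I_n -> _} => nat_of_ord (h i)) H.
    rewrite /= !fval; have := sM' phi i; have := sM' psi i.
    by move: (s (dec phi) ord0 i) (s (dec psi) ord0 i) (M i) => a b c; lia.
  apply/ffunP => i; apply: val_inj => /=.
  by have /rowP/(_ i) := si _ _ Hs; rewrite !mxE; lia.
have sub : codom f \subset family (fun i : 'I_n =>
  [pred x : 'I_B.*2.+1 | (x < (M i).*2.+1)%N]).
  apply/fintype.subsetP => _ /codomP[phi ->]; apply/familyP => i.
  by rewrite inE fval; have := sM' phi i; lia.
have := subset_leq_card sub; rewrite card_codom// card_ffun !card_ord.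
move=> /leq_trans; apply; rewrite card_family foldrE big_map big_enum /=.
apply: leq_prod => i _.
rewrite cardE -(size_map val) -[leqRHS](size_iota 0); apply: uniq_leq_size.
  by rewrite map_inj_uniq ?enum_uniq//; exact: val_inj.
by move=> _ /mapP[x + ->]; rewrite mem_enum mem_iota add0n.
Qed.

Lemma continuous_prod_at (R : realType) (T : topologicalType) (n : nat) (F : 'I_n
  -> T -> R) (x : T) :
  (forall i, {for x, continuous (F i)}) ->
  {for x, continuous (fun y => \prod_i F i y)}.
Proof.
move=> H; elim: n F H => [|n IH] F H.
  rewrite (_ : (fun y => _) = cst 1); first exact: cst_continuous.
  by apply/funext => y; rewrite big_ord0.
rewrite (_ : (fun y => _) = fun y => F ord0 y * \prod_(i < n) F (lift ord0 i) y).
  by apply: (@continuousM R T (F ord0) (fun y => _)); [exact: H|apply: IH].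
by apply/funext => y; rewrite big_ord_recl.
Qed.

Lemma compact_rV_ball (R : realType) (n : nat) (r : R) : compact [set x : 'rV[R]_n
  | `|x| <= r].
Proof.
apply: bounded_closed_compact.
  exists r; split; first exact: num_real.
  by move=> M rM x /= xr; apply: le_trans xr (ltW rM).
apply: (@preimage_closed _ _ (fun x : 'rV[R]_n => `|x|) [set y | y <= r]);
  last exact: closed_le.
by move=> x _; exact: norm_continuous.
Qed.

(* Counting lattice points: the [(2 m + 1) ^ n] points of the cube of radius
   [r] are mapped injectively into a box of sides about [2 r * dl i]. *)
Lemma lattice_limit_box (R : realType) (n : nat) (F : 'rV[R]_n ->
  'rV[R]_n) (dl : 'I_n -> R) :
  lattice_limit F -> (forall i, 0 <= dl i) ->
  (forall e : R, 0 < e ->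
    \forall x \near (0 : 'rV[R]_n), forall i, `|F x ord0 i| <= (dl i + e) * `|x|) ->
  1 <= \prod_i dl i.
Proof.
move=> [s si Hs] dl0 HF.
have main (e : R) : 0 < e -> 1 <= \prod_i (dl i + 3 * e).
  move=> e0; have /nbhs_ballP[rho /= rho0 Hrho] := HF e e0.
  pose j := Num.truncn (rho^-1); pose r : R := j.+1%:R^-1.
  have r0 : 0 < r by rewrite invr_gt0 ltr0n.
  have rrho : r < rho.
    rewrite -[rho]invrK ltf_pV2 ?posrE ?ltr0n ?invr_gt0//.
    by have /truncn_itv/andP[] : 0 <= rho^-1 by rewrite invr_ge0 ltW.
  have Fr x i : `|x| <= r -> `|F x ord0 i| <= (dl i + e) * r.
    move=> xr; have xrho : ball (0 : 'rV[R]_n) rho x.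
      by rewrite -ball_normE /= sub0r normrN; exact: le_lt_trans xr rrho.
    by apply: le_trans (Hrho x xrho i) _; rewrite ler_wpM2l// addr_ge0// ltW.
  pose P (N : nat) (x : 'rV[R]_n) := forall k, lattice_point R N k = x ->
    forall i, `|lattice_point R N (s N k) ord0 i| <= (dl i + 2 * e) * r.
  have [N0 _ HN0] : \forall N \near \oo, [set x : 'rV[R]_n | `|x| <= r] `<=` P N.
    have cov := iffLR (compact_near_coveringP _) (@compact_rV_ball R n r).
    apply: (cov nat \oo P eventually_filter) => z /= zr.
    have [q q0 [N0 H]] := Hs z (e * r) (mulr_gt0 e0 r0).
    exists (ball z q, [set N | (N0 <= N)%N]) => /=.
      by split; [exact: nbhsx_ballx|exists N0].
    move=> [x N] /= [zx N0N] k kx i.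
    have := H N N0N k; rewrite kx.
    have xz : `|x - z| < q by move: zx; rewrite -ball_normE /= distrC.
    move=> /(_ xz) => {}H.
    have -> : lattice_point R N (s N k) ord0 i = (lattice_point R N (s N k) - F z)
      ord0 i + F z ord0 i.
      by rewrite !mxE subrK.
    apply: le_trans (ler_normD _ _) _.
    have -> : (dl i + 2 * e) * r = e * r + (dl i + e) * r by ring.
    apply: lerD; last exact: Fr.
    exact: le_trans (rV_coord_le _ _) (ltW H).
  pose m := (N0.+1 + (Num.truncn (e^-1)).+1)%N.
  pose N := (m * j.+1).-1.
  have NE : N.+1 = (m * j.+1)%N by rewrite /N prednK// muln_gt0 /m addn_gt0.
  have N0N : (N0 <= N)%N.
    by rewrite -ltnS NE /m; apply: leq_trans (leq_pmulr _ _) => //; rewrite leq_addr.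
  have m0 : 0 < m%:R :> R by rewrite ltr0n /m.
  have em : (2 * m%:R)^-1 <= e.
    rewrite -[e]invrK lef_pV2 ?posrE ?invr_gt0 ?mulr_gt0//.
    have : e^-1 < (Num.truncn (e^-1)).+1%:R.
      by have /truncn_itv/andP[] : 0 <= e^-1 by rewrite invr_ge0 ltW.
    have : (Num.truncn e^-1).+1%:R <= m%:R :> R by rewrite ler_nat leq_addl.
    lra.
  have Nr : N.+1%:R = m%:R / r :> R by rewrite NE natrM /r invrK.
  have rm0 : 0 <= r / m%:R by rewrite divr_ge0// ltW.
  pose M i := Num.truncn ((dl i + 2 * e) * m%:R).
  have dle i : 0 <= dl i + 2 * e by rewrite addr_ge0// mulr_ge0// ltW.
  have absE (a : int) : `|a|%N%:R = `|a%:~R| :> R by rewrite natr_absz intr_norm.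
  have := @injective_box_card n m M (s N) (si N).
  have box (k : 'rV[int]_n) : (forall i, (`|k ord0 i| <= m)%N) -> forall i,
    (`|s N k ord0 i| <= M i)%N.
    move=> km i; rewrite truncn_ge_nat ?mulr_ge0// absE.
    have kr : `|lattice_point R N k| <= r.
      apply: rV_norm_le; first exact: ltW.
      move=> l; rewrite mxE Nr invf_div normrM (ger0_norm rm0).
      rewrite mulrCA -[leRHS]mulr1; apply: ler_wpM2l; first exact: ltW.
      by rewrite ler_pdivrMr// mul1r -absE ler_nat.
    have := HN0 N N0N _ kr k erefl i.
    rewrite mxE Nr invf_div normrM (ger0_norm rm0).
    by rewrite mulrCA [_ * r]mulrC ler_pM2l// ler_pdivrMr.
  move=> /(_ box); rewrite -(ler_nat R) natrX.
  have -> : (\prod_i (M i).*2.+1)%:R = \prod_i ((M i).*2.+1)%:R :> R.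
    by rewrite natr_prod.
  move=> H.
  have H1 : (2 * m%:R) ^+ n <= \prod_i ((2 * m%:R) * (dl i + 3 * e)).
    apply: (@le_trans _ _ (m.*2.+1%:R ^+ n)).
      by rewrite lerXn2r ?nnegrE ?mulr_ge0 ?ler0n// -natrM ler_nat mul2n leqW.
    apply: (le_trans H); apply: ler_prod => i _; rewrite ler0n /=.
    have : (M i)%:R <= (dl i + 2 * e) * m%:R by rewrite truncn_le mulr_ge0.
    have -> : ((M i).*2.+1)%:R = 2 * (M i)%:R + 1 :> R.
      by rewrite -addn1 natrD -mul2n natrM.
    have : 1 <= 2 * m%:R * e.
      by rewrite mulrC -ler_pdivrMr ?mulr_gt0// mul1r.
    lra.
  move: H1; rewrite big_split /= prodr_const card_ord ler_pMr//.
  by rewrite exprn_gt0// mulr_gt0.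
have c : {for (0 : R), continuous (fun e : R => \prod_i (dl i + 3 * e))}.
  apply: continuous_prod_at => i.
  have c3 : {for (0 : R), continuous (fun e : R => 3 * e)}.
    by apply: (@continuousM R R (fun=> 3) (fun e : R => e));
      [exact: cst_continuous|exact: cvg_id].
  apply: (@continuousD R R R (fun=> dl i) (fun e : R => 3 * e)); last exact: c3.
  exact: cst_continuous.
apply/ler_addgt0Pr => eta eta0.
move/cvgrPdist_le : c => /(_ eta eta0) /nbhs_ballP[r /= r0 H].
have r20 : 0 < r / 2 by rewrite divr_gt0.
have br : ball (0 : R) r (r / 2).
  by rewrite /ball /= sub0r normrN gtr0_norm//; lra.
have := H _ br; have -> : \prod_i (dl i + 3 * 0) = \prod_i dl i.
  by apply: eq_bigr => i _; rewrite mulr0 addr0.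
have := main _ r20; rewrite ler_norml; lra.
Qed.

Lemma is_diff_mulmx (R : realType) (n m : nat) (B : 'M[R]_(n, m)) (x : 'rV[R]_n) :
  is_diff x (fun x : 'rV[R]_n => x *m B) (fun x => x *m B).
Proof.
have cB : continuous (mulmxr B : 'rV[R]_n -> 'rV[R]_m).
  move=> y; apply: differentiable_continuous; apply: differentiable_rV => i.
  rewrite (_ : (fun y => _) = \sum_j (fun y : 'rV[R]_n => y ord0 j *: (B j i : R))).
    apply: differentiable_sum => j; apply: differentiableZl; exact: differentiable_coord.
  by apply/funext => u; rewrite fct_sumE /= mxE.
apply: DiffDef; first exact: (linear_differentiable (f := mulmxr B)).
exact: (diff_lin (f := mulmxr B)).
Qed.

Lemma continuous_mulmx (R : realType) (n m : nat) (B : 'M[R]_(n, m)) :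
  continuous (fun x : 'rV[R]_n => x *m B).
Proof.
by move=> x; apply: differentiable_continuous; case: (is_diff_mulmx B x).
Qed.

Lemma lattice_limit_mulmx (R : realType) (n : nat) (rk : 'I_n -> nat) (X : 'M[R]_n) :
  (forall i j, ~~ (rk i < rk j)%N -> X i j = (i == j)%:R) ->
  lattice_limit (fun x => x *m X).
Proof.
move=> HX; rewrite (_ : (fun x => _) = fun x : 'rV[R]_n => x + x *m (X - 1%:M)).
  apply: (@lattice_limit_triangular R n rk); first exact: continuous_mulmx.
  move=> j x y xy; rewrite !mxE; apply: eq_bigr => i _.
  have [ij|ij] := boolP (rk i < rk j)%N; first by rewrite xy.
  by rewrite !mxE HX// subrr !mulr0.
by apply/funext => x; rewrite mulmxBr mulmx1 addrC subrK.
Qed.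

Lemma lattice_limit_shift (R : realType) (n : nat) (v : 'rV[R]_n) :
  lattice_limit (fun x => x + v).
Proof.
by apply: (@lattice_limit_triangular R n (fun=> 0%N) (fun=> v)) => // x;
  exact: cst_continuous.
Qed.

Lemma unitriangular_inverse (R : realType) (n : nat) (L X : 'M[R]_n) :
  L *m X = 1%:M -> (forall i j : 'I_n, (i <= j)%N -> L i j = (i == j)%:R) ->
  forall i j : 'I_n, (i <= j)%N -> X i j = (i == j)%:R.
Proof.
move=> LX HL i j; have [m] := ubnP (nat_of_ord i); elim: m i j => // m IH i j.
rewrite ltnS => im ij; have /matrixP/(_ i j) := LX.
rewrite !mxE (bigD1 i)//= HL// eqxx mul1r big1 ?addr0// => k ki.
have [ki'|ik] := ltnP k i.
  rewrite IH ?(leq_trans ki')// ?(leq_trans (ltnW ki'))//.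
  suff /negbTE-> : k != j by rewrite mulr0.
  by rewrite neq_ltn (leq_trans ki').
by rewrite HL// eq_sym (negbTE ki) mul0r.
Qed.

Lemma lattice_limit_diff (R : realType) (n : nat) (F : 'rV[R]_n -> 'rV[R]_n)
    (z : 'rV[R]_n) (S T : 'M[R]_n) :
  lattice_limit F -> differentiable F z ->
  lattice_limit (fun x => x *m S) -> lattice_limit (fun x => x *m T) ->
  1 <= \prod_i \sum_j `|(S *m 'J F z *m T) j i|.
Proof.
move=> lF dF lS lT; set B := S *m 'J F z *m T.
pose G (x : 'rV[R]_n) := (F (x *m S + z) + - F z) *m T.
apply: (@lattice_limit_box R n G).
- have l1 := lattice_limit_comp lS (lattice_limit_shift z).
  have l2 := lattice_limit_comp l1 lF.
  have l3 := lattice_limit_comp l2 (lattice_limit_shift (- F z)).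
  exact: (lattice_limit_comp l3 lT).
- by move=> i; apply: sumr_ge0.
- move=> e e0.
  have dA : is_diff 0 (fun x : 'rV[R]_n => x *m S + z) (fun x => x *m S).
    apply: (@is_diff_eq _ _ _ _ _ _ _ (@is_diffD _ _ _ _ _ _ _ _ (is_diff_mulmx S
      0) (is_diff_cst z 0))).
    by apply/funext => x; rewrite !fctE addr0.
  have A0 : 0 *m S + z = z by rewrite mul0mx add0r.
  have dA0 : differentiable (fun x : 'rV[R]_n => x *m S + z) 0 by apply: ex_diff.
  have dFA0 : differentiable F (0 *m S + z) by rewrite A0.
  have dFA : differentiable (fun x : 'rV[R]_n => F (x *m S + z)) 0.
    exact: (@differentiable_comp _ _ _ _ (fun x : 'rV[R]_n => x *m S + z) F).
  have dH : is_diff 0 (fun x : 'rV[R]_n => F (x *m S + z) + - F z) (fun x =>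
    x *m S *m 'J F z).
    apply: (@is_diff_eq _ _ _ _ _ _ _ (@is_diffD _ _ _ _ _ _ _ _ (differentiableP
      dFA) (is_diff_cst (- F z) 0))).
    apply/funext => x; rewrite !fctE addr0.
    apply: (etrans (diff_comp_at (f := fun x => x *m S + z) _ dA0 dFA0)).
    have E1 : 'd F (0 *m S + z) = 'd F z :> (_ -> _) by rewrite A0.
    have E2 := @diff_val _ _ _ _ _ _ _ dA.
    apply: (etrans (congr1 (fun f => f _) E1)).
    apply: (etrans (congr1 (fun y => 'd F z y) (congr1 (fun f => f x) E2))).
    by rewrite /jacobian mul_rV_lin1.
  have dG : is_diff 0 G (fun x => x *m B).
    apply: (@is_diff_eq _ _ _ _ _ _ _ (@is_diff_comp _ _ _ _ _ _ _ _ _ dH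
      (is_diff_mulmx T _))).
    by apply/funext => x; rewrite /= /B !mulmxA.
  have G0 : G 0 = 0 by rewrite /G A0 subrr mul0mx.
  have dG0 : differentiable G 0 by apply: ex_diff.
  apply: filterS (diff_approx dG0 e0) => x; rewrite diff_val G0 !subr0 => Hx i.
  have -> : G x ord0 i = (G x - x *m B) ord0 i + (x *m B) ord0 i by rewrite !mxE subrK.
  apply: le_trans (ler_normD _ _) _; rewrite mulrDl addrC; apply: lerD.
    rewrite mxE mulr_suml; apply: le_trans (ler_norm_sum _ _ _) _.
    apply: ler_sum => j _; rewrite normrM mulrC ler_wpM2l//; exact: rV_coord_le.
  exact: le_trans (rV_coord_le _ _) Hx.
Qed.

Lemma det_lattice_limit_ge1 (R : realType) (n : nat) (F : 'rV[R]_n ->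
  'rV[R]_n) (z : 'rV[R]_n) :
  lattice_limit F -> differentiable F z -> 1 <= `|\det ('J F z)|.
Proof.
case: n F z => [|n] F z lF dF; first by rewrite det_mx00 normr1.
set A := 'J F z.
have l1 : lattice_limit (fun x : 'rV[R]_n.+1 => x *m 1%:M).
  by apply: (@lattice_limit_mulmx R n.+1 (fun=> 0%N)) => i j _; rewrite mxE.
have [detA|detA] := eqVneq (\det A) 0.
  have /det0P[v v0 vA] : \det A^T == 0 by rewrite det_tr detA.
  have [j vj] : exists j, v ord0 j != 0.
    by apply/existsP; apply: contraNT v0; rewrite negb_exists => /forallP H;
       apply/eqP/rowP => j; rewrite mxE; apply/eqP; have := H j; rewrite negbK.
  pose X : 'M[R]_n.+1 := \matrix_(i,
    l) (if l == j then v ord0 i / v ord0 j else (i == l)%:R).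
  have lX : lattice_limit (fun x => x *m X).
    apply: (@lattice_limit_mulmx R n.+1 (fun l => (l == j) : nat)) => i l.
    rewrite mxE; have [->|lj] := eqVneq l j; last by [].
    by have [->|ij] := eqVneq i j => //; rewrite divff.
  have := lattice_limit_diff lF dF l1 lX; rewrite mul1mx -/A.
  rewrite (bigD1 j)//= big1 ?mul0r ?ler10// => i _.
  apply/eqP; rewrite normr_eq0 mxE.
  under eq_bigr => k _ do rewrite [X _ _]mxE eqxx mulrA.
  rewrite -mulr_suml; have /rowP/(_ i) := vA; rewrite mxE [RHS]mxE => H.
  rewrite (eq_bigr (fun k => v ord0 k * A^T k i)) ?H ?mul0r// => k _.
  by rewrite [A^T _ _]mxE mulrC.
have := cormen_lup_correct A; have := cormen_lup_perm A; have := cormen_lup_detL A.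
have := @cormen_lup_lower _ _ A; have := @cormen_lup_upper _ _ A.
case: (cormen_lup A) => [[P L] U] /= Uup Llow detL Pperm PA.
have uL : L \in unitmx by rewrite unitmxE detL unitr1.
have Lil : forall i j : 'I_n.+1, (i <= j)%N -> (invmx L) i j = (i == j)%:R.
  exact: (unitriangular_inverse (mulmxV uL)).
have /is_perm_mxP[p Pp] := Pperm.
have detP : `|\det P| = 1 by rewrite Pp det_perm normr_sign.
have detAU : `|\det A| = `|\prod_i U i i|.
  have := congr1 (fun M : 'M[R]_n.+1 => `|\det M|) PA.
  rewrite -!mulmxE !det_mulmx detL mul1r normrM detP mul1r => ->.
  rewrite -(det_tr U) det_trig; last first.
    by apply/is_trig_mxP => i j ij; rewrite mxE Uup.
  by congr (`|_|); apply: eq_bigr => i _; rewrite mxE.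
have Uii i : U i i != 0.
  by move: detA; rewrite -normr_eq0 detAU normr_eq0 => /prodf_neq0/(_ i isT).
pose U' := diag_mx (\row_i (U i i)^-1) *m U.
have U'E i j : U' i j = (U i i)^-1 * U i j by rewrite /U' mul_diag_mx !mxE.
have uU' : U' \in unitmx.
  rewrite unitmxE -det_tr det_trig; last first.
    by apply/is_trig_mxP => i j ij; rewrite mxE U'E (Uup _ _ ij) mulr0.
  rewrite big1 ?unitr1// => i _; by rewrite mxE U'E mulVf.
have U'il : forall i j : 'I_n.+1, (i <= j)%N -> (invmx U')^T i j = (i == j)%:R.
  apply: (@unitriangular_inverse R n.+1 U'^T).
    by rewrite -trmx_mul mulVmx// trmx1.
  move=> i j; rewrite mxE U'E leq_eqVlt => /orP[/eqP/val_inj->|ij].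
    by rewrite mulVf// eqxx.
  by rewrite (Uup _ _ ij) mulr0 (_ : i == j = false)//; apply/negbTE; rewrite neq_ltn ij.
have lS : lattice_limit (fun x => x *m (invmx L *m P)).
  have lL : lattice_limit (fun x => x *m invmx L).
    apply: (@lattice_limit_mulmx R n.+1 (fun i => n - i)%N) => i j.
    by rewrite -leqNgt => h; apply: Lil; have := ltn_ord i; have := ltn_ord j;
      move: h; lia.
  have lP : lattice_limit (fun x : 'rV[R]_n.+1 => x *m P).
    rewrite (_ : (fun x => _) = fun x : 'rV[R]_n.+1 => col_perm (p^-1)%g x).
      exact: lattice_limit_perm.
    by apply/funext => x; rewrite Pp col_permE invgK.
  rewrite (_ : (fun x => _) = (fun x => x *m P) \o (fun x => x *m invmx L)).
    exact: lattice_limit_comp.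
  by apply/funext => x; rewrite /= mulmxA.
have lT : lattice_limit (fun x => x *m invmx U').
  apply: (@lattice_limit_mulmx R n.+1 (fun i => i : nat)) => i j.
  by rewrite -leqNgt => h; have := U'il j i h; rewrite mxE eq_sym.
have := lattice_limit_diff lF dF lS lT; rewrite -/A.
have -> : invmx L *m P *m A *m invmx U' = diag_mx (\row_i U i i).
  have -> : invmx L *m P *m A = U.
    by rewrite -mulmxA mulmxE PA -mulmxE mulKmx.
  have E : U = diag_mx (\row_i U i i) *m U'.
    by apply/matrixP => i j; rewrite mul_diag_mx [RHS]mxE U'E [X in X * _]mxE mulVKf.
  by rewrite {1}E mulmxK.
rewrite detAU normr_prod => /le_trans; apply; rewrite le_eqVlt; apply/orP; left.
apply/eqP; apply: eq_bigr => i _; rewrite (bigD1 i)//= big1 ?addr0.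
  by rewrite !mxE eqxx mulr1n.
by move=> j ji; rewrite !mxE (negbTE ji) mulr0n normr0.
Qed.

Lemma is_diff_inverse (R : realType) (n : nat) (F G : 'rV[R]_n ->
  'rV[R]_n) (z : 'rV[R]_n) :
  cancel F G -> cancel G F -> differentiable F z -> 'J F z \in unitmx ->
  {for F z, continuous G} -> is_diff (F z) G (fun y => y *m invmx ('J F z)).
Proof.
move=> FG GF dF uJ cG; set A := 'J F z; set w := F z.
pose L : {linear 'rV[R]_n -> 'rV[R]_n} := mulmxr (invmx A).
have cL : continuous L by exact: continuous_mulmx.
have [C C0 LC] := linear_lipschitz cL.
apply: (is_diff_approx (L := L)) => // e e0.
have [e1 [e10 e1C e1e]] : exists e1 : R, [/\ 0 < e1,
  C * e1 <= 1 / 2 & C * e1 * (2 * C) <= e].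
  exists (Num.min (1 / (2 * C)) (e / (2 * C * C))); split.
  - by rewrite lt_min !divr_gt0 ?mulr_gt0.
  - apply: (@le_trans _ _ (C * (1 / (2 * C)))); first by rewrite ler_pM2l// ge_min lexx.
    by rewrite le_eqVlt; apply/orP; left; apply/eqP; field; rewrite gt_eqF.
  - set m := Num.min _ _; have -> : C * m * (2 * C) = m * (2 * C * C) by ring.
    by rewrite -ler_pdivlMr ?mulr_gt0// ge_min lexx orbT.
have := diff_approx dF e10.
have GwE : G w = z by exact: FG.
move=> /nbhs_ballP[r /= r0 H].
move/cvgrPdist_lt : cG => /(_ r r0); rewrite -/w GwE.
apply: filterS => y yr; set x := G y.
have xr : ball z r x by rewrite -ball_normE.
have := H x xr; rewrite {1}/x GF -/w.
have -> : 'd F z (x - z) = (x - z) *m A by rewrite /A /jacobian mul_rV_lin1.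
set rho := y - w - (x - z) *m A => hrho.
have E : x - z - L (y - w) = - L rho.
  have LE v : L v = v *m invmx A by [].
  by rewrite !LE /rho [in RHS]mulmxBl mulmxK// opprB.
have h1 : `|L rho| <= C * e1 * `|x - z|.
  by apply: le_trans (LC _) _; rewrite -mulrA ler_pM2l.
have h2 : `|x - z| <= 2 * C * `|y - w|.
  have t1 : `|x - z| <= `|L (y - w)| + `|L rho|.
    by rewrite -{1}(subrK (L (y - w)) (x - z)) E addrC; exact: ler_normB.
  have t2 := LC (y - w).
  have : C * e1 * `|x - z| <= 1 / 2 * `|x - z| by rewrite ler_wpM2r.
  lra.
rewrite E normrN; apply: le_trans h1 _.
apply: (@le_trans _ _ (C * e1 * (2 * C * `|y - w|))).
  by apply: ler_wpM2l h2; rewrite mulr_ge0// ltW.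
by rewrite mulrA ler_wpM2r.
Qed.

Lemma det_lattice_homeo (R : realType) (n : nat) (F G : 'rV[R]_n ->
  'rV[R]_n) (z : 'rV[R]_n) :
  cancel F G -> cancel G F -> lattice_limit F -> lattice_limit G -> continuous G ->
  differentiable F z -> `|\det ('J F z)| = 1.
Proof.
move=> FG GF lF lG cG dF; have ge1 := det_lattice_limit_ge1 lF dF.
have detJ : \det ('J F z) != 0.
  by rewrite -normr_gt0; apply: lt_le_trans ge1.
have uJ : 'J F z \in unitmx by rewrite unitmxE unitfE.
have dG := is_diff_inverse FG GF dF uJ (cG _).
have dG' : differentiable G (F z) by apply: ex_diff.
have JG : 'J G (F z) = invmx ('J F z).
  apply/row_matrixP => i; rewrite !rowE /jacobian mul_rV_lin1.
  exact: (congr1 (fun f => f _) (@diff_val _ _ _ _ _ _ _ dG)).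
have := det_lattice_limit_ge1 lG dG'.
rewrite JG det_inv normfV => ge1'; apply/eqP; rewrite eq_le ge1 andbT.
by move: ge1'; rewrite -[1 <= _]invf_le1 ?invrK// invr_gt0 normr_gt0.
Qed.

(** * The integrator as a product of shears *)

Definition kick (R : realType) (d : nat) (h : 'rV[R]_d -> 'rV[R]_d)
  (z : 'rV[R]_(d + d)) : 'rV[R]_(d + d) := row_mx (qpart z) (ppart z + h (qpart z)).

Definition drift (R : realType) (d : nat) (h : 'rV[R]_d -> 'rV[R]_d)
  (z : 'rV[R]_(d + d)) : 'rV[R]_(d + d) := row_mx (qpart z + h (ppart z)) (ppart z).

Inductive shear_product (R : realType) (d : nat) :
    ('rV[R]_(d + d) -> 'rV[R]_(d + d)) -> Prop :=
| shear_id : shear_product id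
| shear_kick (h : 'rV[R]_d -> 'rV[R]_d) F : continuous h -> shear_product F ->
  shear_product (kick h \o F)
| shear_drift (h : 'rV[R]_d -> 'rV[R]_d) F : continuous h -> shear_product F ->
  shear_product (drift h \o F).

Lemma shear_product_comp (R : realType) (d : nat) (F G : 'rV[R]_(d + d) ->
  'rV[R]_(d + d)) :
  shear_product F -> shear_product G -> shear_product (F \o G).
Proof.
move=> + sG; elim=> {F}; first exact: sG.
- by move=> h F ch _ IH; exact: (shear_kick ch IH).
- by move=> h F ch _ IH; exact: (shear_drift ch IH).
Qed.

Lemma qpart_row (R : realType) (d : nat) (q p : 'rV[R]_d) : qpart (row_mx q p) = q.
Proof. exact: row_mxKl. Qed.

Lemma ppart_row (R : realType) (d : nat) (q p : 'rV[R]_d) : ppart (row_mx q p) = p.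
Proof. exact: row_mxKr. Qed.

Lemma row_qp (R : realType) (d : nat) (z : 'rV[R]_(d + d)) : row_mx (qpart z)
  (ppart z) = z.
Proof. exact: hsubmxK. Qed.

Lemma kickK (R : realType) (d : nat) (h : 'rV[R]_d -> 'rV[R]_d) :
  cancel (kick h) (kick (fun q => - h q)).
Proof. by move=> z; rewrite /kick qpart_row ppart_row addrK row_qp. Qed.

Lemma driftK (R : realType) (d : nat) (h : 'rV[R]_d -> 'rV[R]_d) :
  cancel (drift h) (drift (fun q => - h q)).
Proof. by move=> z; rewrite /drift qpart_row ppart_row addrK row_qp. Qed.

Lemma shear_product_inverse (R : realType) (d : nat) (F : 'rV[R]_(d + d) ->
  'rV[R]_(d + d)) :
  shear_product F -> exists G, [/\ shear_product G, cancel F G & cancel G F].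
Proof.
elim=> {F}; first by exists id; split => //; exact: shear_id.
- move=> h F ch _ [G [sG FG GF]]; exists (G \o kick (fun q => - h q)).
  have cNh : continuous (fun q => - h q) by move=> q; exact: (continuousN (ch q)).
  split.
  + exact: shear_product_comp sG (shear_kick cNh (shear_id _ _)).
  + by move=> z; rewrite /= kickK FG.
  + move=> z; rewrite /= GF; have := kickK (fun q => - h q) z.
    by rewrite (_ : (fun q => - - h q) = h)//; apply/funext => q; rewrite opprK.
- move=> h F ch _ [G [sG FG GF]]; exists (G \o drift (fun q => - h q)).
  have cNh : continuous (fun q => - h q) by move=> q; exact: (continuousN (ch q)).
  split.
  + exact: shear_product_comp sG (shear_drift cNh (shear_id _ _)).
  + by move=> z; rewrite /= driftK FG.
  + move=> z; rewrite /= GF; have := driftK (fun q => - h q) z.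
    by rewrite (_ : (fun q => - - h q) = h)//; apply/funext => q; rewrite opprK.
Qed.

Lemma continuous_rV (R : realType) (T : topologicalType) (n : nat) (F : T -> 'rV[R]_n) :
  (forall i, continuous (fun x => F x ord0 i)) -> continuous F.
Proof.
move=> H x; apply/cvgrPdist_lt => e e0.
have : \forall y \near x, forall i, `|F x ord0 i - F y ord0 i| < e.
  by apply: filter_forall => i; have := H i x; move/cvgrPdist_lt; apply.
by apply: filterS => y Hy; apply: rV_norm_lt => // i; have := Hy i; rewrite !mxE.
Qed.

Definition block_shift (R : realType) (d : nat) (b : bool) (h : 'rV[R]_d -> 'rV[R]_d)
  (z : 'rV[R]_(d + d)) : 'rV[R]_(d + d) :=
  if b then row_mx 0 (h (qpart z)) else row_mx (h (ppart z)) 0.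

Lemma continuous_block_shift (R : realType) (d : nat) (b : bool) (h : 'rV[R]_d ->
  'rV[R]_d) :
  continuous h -> continuous (block_shift b h).
Proof.
move=> ch; apply: continuous_rV => i; case: b; rewrite /block_shift;
  case: (split_ordP i) => j ->.
- rewrite (_ : (fun x => _) = cst 0); first exact: cst_continuous.
  by apply/funext => x; rewrite row_mxEl mxE.
- rewrite (_ : (fun x => _) = (fun M : 'rV[R]_d => M ord0 j) \o (h \o @qpart R d)).
    move=> x; apply: continuous_comp; last exact: coord_continuous.
    by apply: continuous_comp; [exact: continuous_lsubmx|exact: ch].
  by apply/funext => x; rewrite row_mxEr.
- rewrite (_ : (fun x => _) = (fun M : 'rV[R]_d => M ord0 j) \o (h \o @ppart R d)).
    move=> x; apply: continuous_comp; last exact: coord_continuous.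
    by apply: continuous_comp; [exact: continuous_rsubmx|exact: ch].
  by apply/funext => x; rewrite row_mxEl.
- rewrite (_ : (fun x => _) = cst 0); first exact: cst_continuous.
  by apply/funext => x; rewrite row_mxEr mxE.
Qed.

Lemma kickE (R : realType) (d : nat) (h : 'rV[R]_d -> 'rV[R]_d) :
  kick h = fun z => z + block_shift true h z.
Proof. by apply/funext => z; rewrite /kick /block_shift -[X in _ = X + _]row_qp
  add_row_mx addr0. Qed.

Lemma driftE (R : realType) (d : nat) (h : 'rV[R]_d -> 'rV[R]_d) :
  drift h = fun z => z + block_shift false h z.
Proof. by apply/funext => z; rewrite /drift /block_shift -[X in _ = X + _]row_qp
  add_row_mx addr0. Qed.

Lemma shear_product_lattice_limit (R : realType) (d : nat) (F : 'rV[R]_(d + d) ->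
  'rV[R]_(d + d)) :
  shear_product F -> lattice_limit F /\ continuous F.
Proof.
elim=> {F}.
- split; last by move=> z; exact: cvg_id.
  by have := @lattice_limit_shift R (d + d) 0; rewrite (_ : (fun x => _) = id)//;
    apply/funext => x; rewrite addr0.
- move=> h F ch _ [lF cF]; have cb := @continuous_block_shift R d true h ch; split.
    apply: lattice_limit_comp lF _; rewrite kickE.
    apply: (@lattice_limit_triangular R (d + d) (fun i =>
      (d <= i)%N : nat) (block_shift true h) cb).
    move=> j x y; rewrite /block_shift; case: (split_ordP j) => i ->.
      by rewrite !row_mxEl !mxE.
    rewrite !row_mxEr /= leq_addr => H.
    have -> // : qpart x = qpart y.
    by apply/rowP => k; rewrite !mxE; apply: H; rewrite /= [(d <= k)%N]leqNgt ltn_ord.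
  move=> z; apply: continuous_comp; first exact: cF.
  rewrite kickE; exact: (continuousD (@cvg_id _ _) (cb _)).
- move=> h F ch _ [lF cF]; have cb := @continuous_block_shift R d false h ch; split.
    apply: lattice_limit_comp lF _; rewrite driftE.
    apply: (@lattice_limit_triangular R (d + d) (fun i =>
      (i < d)%N : nat) (block_shift false h) cb).
    move=> j x y; rewrite /block_shift; case: (split_ordP j) => i ->; last first.
      by rewrite !row_mxEr !mxE.
    rewrite !row_mxEl /= => H.
    have -> // : ppart x = ppart y.
    apply/rowP => k; rewrite !mxE; apply: H.
    by rewrite [(rshift d k < d)%N]ltnNge leq_addr.
  move=> z; apply: continuous_comp; first exact: cF.
  rewrite driftE; exact: (continuousD (@cvg_id _ _) (cb _)).
Qed.

Lemma shear_product_det (R : realType) (d : nat) (F : 'rV[R]_(d + d) -> 'rV[R]_(d + d))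
    (z : 'rV[R]_(d + d)) : shear_product F -> differentiable F z -> `|\det (Jac F z)| = 1.
Proof.
move=> sF dF; have [G [sG FG GF]] := shear_product_inverse sF.
have [lF _] := shear_product_lattice_limit sF.
have [lG cG] := shear_product_lattice_limit sG.
by rewrite /Jac det_tr; exact: det_lattice_homeo FG GF lF lG cG dF.
Qed.

Definition rescale (R : realType) (d : nat) (a : R) (z : 'rV[R]_(d + d)) :
  'rV[R]_(d + d) :=
  row_mx (qpart z) (a *: ppart z).

Lemma rescaleA (R : realType) (d : nat) (a b : R) (z : 'rV[R]_(d + d)) :
  rescale a (rescale b z) = rescale (a * b) z.
Proof. by rewrite /rescale qpart_row ppart_row scalerA. Qed.

Lemma rescale1 (R : realType) (d : nat) (z : 'rV[R]_(d + d)) : rescale 1 z = z.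
Proof. by rewrite /rescale scale1r row_qp. Qed.

Lemma rescale_shear_product (R : realType) (d : nat) (a : R)
    (F : 'rV[R]_(d + d) -> 'rV[R]_(d + d)) : a != 0 -> shear_product F ->
  exists2 G, shear_product G & forall z, rescale a (F z) = G (rescale a z).
Proof.
move=> a0; elim=> {F}; first by exists id => //; exact: shear_id.
- move=> h F ch _ [G sG FG]; exists (kick (fun q => a *: h q) \o G).
    apply: shear_kick sG => q.
    exact: (continuousZl_tmp (ch q)).
  move=> z; rewrite /= -FG /rescale /kick !qpart_row !ppart_row.
  by rewrite scalerDr.
- move=> h F ch _ [G sG FG]; exists (drift (fun p => h (a^-1 *: p)) \o G).
    apply: shear_drift sG => p.
    apply: (@continuous_comp _ _ _ (fun p : 'rV[R]_d => a^-1 *: p) h); last exact: ch.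
    exact: scaler_continuous.
  move=> z; rewrite /= -FG /rescale /drift !qpart_row !ppart_row.
  by rewrite scalerA mulVf// scale1r.
Qed.

Lemma iter_rescale_shear_product (R : realType) (d : nat) (a : R)
    (F : 'rV[R]_(d + d) -> 'rV[R]_(d + d)) (n : nat) : a != 0 -> shear_product F ->
  exists2 G, shear_product G & forall z,
    iter n (fun z => rescale a (F (rescale a z))) z = G (rescale (a ^+ (n + n)) z).
Proof.
move=> a0 sF; elim: n => [|n [G sG IH]].
  by exists id => [|z]; [exact: shear_id|rewrite addn0 expr0 rescale1].
have [F1 sF1 E1] := rescale_shear_product a0 sF.
have aa0 : a * a != 0 by rewrite mulf_neq0.
have [G1 sG1 E2] := rescale_shear_product aa0 sG.
exists (F1 \o G1); first exact: shear_product_comp.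
move=> z; rewrite iterS IH E1 rescaleA E2 rescaleA /=.
by rewrite addSn addnS !exprS mulrA.
Qed.

Lemma shear_product_PhiH (R : realType) (d : nat) (U : 'rV[R]_d ->
  R) (Sigma : 'M[R]_d) (eps : R) :
  continuous (grad U) -> shear_product (PhiH U Sigma eps).
Proof.
move=> cU.
have ck : continuous (fun q => - ((eps / 2) *: grad U q)).
  move=> q; apply: (@continuousN _ _ _ (fun q => (eps / 2) *: grad U q)).
  exact: (continuousZl_tmp (cU q)).
have cd : continuous (fun p : 'rV[R]_d => eps *: (p *m (invmx Sigma)^T)).
  by move=> p; exact: (continuousZl_tmp (@continuous_mulmx _ _ _ _ p)).
exact: (shear_kick ck (shear_drift cd (shear_kick ck (shear_id R d)))).
Qed.

Lemma shear_product_Psi_num (R : realType) (d : nat) (U : 'rV[R]_d -> R) (Sigma : 'M[R]_d)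
    (gamma eps : R) (L : nat) :
  continuous (grad U) -> shear_product (Psi_num U Sigma gamma eps L).
Proof.
move=> cU; have sPhi := shear_product_PhiH Sigma eps cU.
pose a c : R := expR (c * eps / 2).
have a0 c : a c != 0 by rewrite gt_eqF// expR_gt0.
have [G1 sG1 E1] := iter_rescale_shear_product L./2 (a0 (- gamma)) sPhi.
have [G2 sG2 E2] := iter_rescale_shear_product L./2 (a0 gamma) sPhi.
have b0 : a (- gamma) ^+ (L./2 + L./2) != 0 by rewrite expf_neq0.
have [G3 sG3 E3] := rescale_shear_product b0 sG2.
have -> : Psi_num U Sigma gamma eps L = G1 \o G3.
  apply/funext => z; apply: (etrans (E1 _)).
  apply: (etrans (congr1 (fun y => G1 (rescale _ y)) (E2 z))).
  rewrite E3 rescaleA -exprMn.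
  have -> : a (- gamma) * a gamma = 1.
    by rewrite /a -expRD -mulrDl -mulrDl addNr !mul0r expR0.
  by rewrite expr1n rescale1.
exact: shear_product_comp.
Qed.

Theorem mainTheorem2 (R : realType) (d : nat) (hd : (0 < d)%N)
  (U K : 'rV[R]_d -> R) (l gamma T : R)
  (hU : C1 U) (hl : 0 < l) (hUl : elipschitz l U)
  (hK : forall p, differentiable K p)
  (hgamma : 0 < gamma) (hT : 0 < T)
  (Z : R -> 'rV[R]_(d + d) -> 'rV[R]_(d + d))
  (hZ : ra_flow U K gamma T Z) (hZ1 : C1_in_initial_state T Z) :
  [/\ omega Z T = omega Z 0,
      forall t, 0 < t < T -> omega Z t <> omega Z 0,
      forall z, (Jac (Z T) z)^T *m invmx (Omega R d) *m Jac (Z T) z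
                = invmx (Omega R d),
      forall z, `|\det (Jac (Z T) z)| = 1
    & forall (Sigma : 'M[R]_d) (eps : R) (L : nat),
        sympd Sigma -> 0 < eps -> (0 < L)%N ->
        forall z, differentiable (Psi_num U Sigma gamma eps L) z ->
          `|\det (Jac (Psi_num U Sigma gamma eps L) z)| = 1].
Proof.
have [ET Et ES] := exact_flow_symplectic hd hU hK hgamma hT hZ hZ1.
split; [exact: ET|exact: Et|exact: ES| |].
- by move=> z; exact: (symplectic_det (ES z)).
- move=> Sigma eps L _ _ _ z dPsi.
  exact: (shear_product_det (shear_product_Psi_num Sigma gamma eps L hU.2) dPsi).
Qed.
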